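(* Let $(\varphi_n)_{n\in\mathbb{N}}$ be a frame in $\ell^2$ with $\|\varphi_n\|_2=1$ for all $n\in\mathbb{N}$. Then $(\varphi_n)_{n\in\mathbb{N}}$ is the disjoint union of a finite family of Riesz sequences; that is, there exist an integer $r\ge 1$ and a partition $\{A_1,\dots,A_r\}$ of $\mathbb{N}$ such that, for each $j=1,\dots,r$, the family $(\varphi_n)_{n\in A_j}$ is a Riesz sequence.
   Context: $\ell^2=\ell^2(\mathbb{N})$ is the complex Hilbert space of square-summable sequences. A sequence $(\varphi_n)_{n\in\mathbb{N}}$ in a Hilbert space $\mathcal{H}$ is a frame if there exist constants $A,B>0$ such that for every $\xi\in\mathcal{H}$: $A\|\xi\|^2\le\sum_{n\in\mathbb{N}}|\langle\xi|\varphi_n\rangle|^2\le B\|\xi\|^2$. A family $(\varphi_n)_{n\in I}$ (with $I\subset\mathbb{N}$) in $\mathcal{H}$ is a Riesz sequence if there exist constants $A,B>0$ such that for every $\mathbf{a}=(a_n)_{n\in I}\in\ell^2(I)$: $A\|\mathbf{a}\|_2^2\le\|\sum_{n\in I}a_n\varphi_n\|^2\le B\|\mathbf{a}\|_2^2$. *)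

(* Defs.v *)
From HB Require Import structures.
From mathcomp Require Import all_boot all_order all_algebra.
From mathcomp Require Import all_classical all_reals all_analysis.
From mathcomp Require Import complex ring.

Set Implicit Arguments.
Unset Strict Implicit.
Unset Printing Implicit Defensive.

Import Order.TTheory GRing.Theory Num.Theory.
Import numFieldNormedType.Exports.

Local Open Scope classical_set_scope.
Local Open Scope ring_scope.
Local Open Scope complex_scope.

Section SquareSummable.
Context (R : realType).
Implicit Types (I : set nat) (u v : nat -> R[i]).

(* R-valued modulus; the norm `|z| of MathComp takes its values in R[i]. *)
Definition modulus (z : R[i]) : R := ComplexField.Normc.normc z.

(* Only the entries of u with index in I matter, so that a function
   u : nat -> R[i] with sqsum I u < +oo stands for an element of l^2(I). *)
Definition sqsum I u : \bar R := (\esum_(k in I) (modulus (u k) ^+ 2)%:E)%E.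

Definition square_summable : {pred nat -> R[i]} :=
  [pred u | (sqsum setT u < +oo)%E].

Lemma sqsum_ge0 I u : (0 <= sqsum I u)%E.
Proof. by apply: esum_ge0 => k _; rewrite lee_fin sqr_ge0. Qed.

Lemma modulus_ge0 z : 0 <= modulus z.
Proof. by case: z => a b; exact: sqrtr_ge0. Qed.

Lemma sqsumZ c u : sqsum setT (c *: u) = ((modulus c ^+ 2)%:E * sqsum setT u)%E.
Proof.
rewrite /sqsum -!nneseries_esumT; last 2 first.
- by move=> k; rewrite lee_fin sqr_ge0.
- by move=> k; rewrite lee_fin sqr_ge0.
rewrite -nneseriesZl//; last by move=> k _; rewrite lee_fin sqr_ge0.
apply: eq_eseriesr => k _.
by rewrite -EFinM /modulus ComplexField.Normc.normcM exprMn.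
Qed.

Lemma sqsumD u v :
  (sqsum setT (u + v)%R <= 2%:E * (sqsum setT u + sqsum setT v))%E.
Proof.
rewrite /sqsum -esumD; last 2 first.
- by move=> k _; rewrite lee_fin sqr_ge0.
- by move=> k _; rewrite lee_fin sqr_ge0.
rewrite -!nneseries_esumT; last 2 first.
- by move=> k; rewrite adde_ge0// lee_fin sqr_ge0.
- by move=> k; rewrite lee_fin sqr_ge0.
rewrite -nneseriesZl//; last by move=> k _; rewrite adde_ge0// lee_fin sqr_ge0.
apply: lee_nneseries => k _; first by rewrite lee_fin sqr_ge0.
rewrite -EFinD -EFinM lee_fin; apply: (@le_trans _ _
  ((modulus (u k) + modulus (v k)) ^+ 2)).
  rewrite lerXn2r ?nnegrE ?addr_ge0 ?modulus_ge0//.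
  exact: le_normcD.
rewrite -subr_ge0 (_ : _ - _ = (modulus (u k) - modulus (v k)) ^+ 2) ?sqr_ge0//.
by rewrite sqrrD sqrrB mulr2n mulrDl !mul1r; ring.
Qed.

Lemma square_summable_submod : submod_closed square_summable.
Proof.
split=> [|c u v]; rewrite ?inE.
  rewrite /sqsum esum1 ?ltry// => k _.
  by rewrite /modulus ComplexField.Normc.normc0 expr0n.
move=> uoo voo; apply: le_lt_trans (sqsumD _ _) _.
rewrite sqsumZ lte_mul_pinfty ?lee_fin// lte_add_pinfty//.
by rewrite lte_mul_pinfty ?lee_fin ?sqr_ge0.
Qed.

HB.instance Definition _ :=
  GRing.isSubmodClosed.Build R[i] (nat -> R[i]) square_summable
    square_summable_submod.

Record ell2 : Type :=
  Ell2 { ell2_seq :> nat -> R[i]; _ : ell2_seq \in square_summable }.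

HB.instance Definition _ := [isSub for ell2_seq].
HB.instance Definition _ := [Choice of ell2 by <:].
HB.instance Definition _ := [SubChoice_isSubLmodule of ell2 by <:].

Definition ell2_norm (x : ell2) : R := Num.sqrt (fine (sqsum setT x)).

(* The regular algebra R[i]^o is the copy of R[i] that carries the topology. *)
Definition ell2_dot (x y : ell2) : R[i] :=
  limn (series (fun k => x k * (y k)^*%C : R[i]^o)).

Definition is_frame (phi : nat -> ell2) : Prop :=
  exists A B : R, [/\ 0 < A, 0 < B & forall xi : ell2,
    ((A * ell2_norm xi ^+ 2)%:E
       <= \sum_(0 <= n <oo) (modulus (ell2_dot xi (phi n)) ^+ 2)%:E)%E /\
    (\sum_(0 <= n <oo) (modulus (ell2_dot xi (phi n)) ^+ 2)%:E
       <= (B * ell2_norm xi ^+ 2)%:E)%E].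

(* The sum of a family indexed by I is the limit in norm of its partial sums
   taken in increasing order of the indices. *)
Definition is_sum I (f : nat -> ell2) (s : ell2) : Prop :=
  ell2_norm (s - \sum_(0 <= n < N | n \in I) f n) @[N --> \oo] --> (0 : R).

(* The convergence of the series is part of the two inequalities. *)
Definition is_riesz_sequence I (phi : nat -> ell2) : Prop :=
  exists A B : R, [/\ 0 < A, 0 < B & forall a : nat -> R[i],
    (sqsum I a < +oo)%E ->
    exists s : ell2, [/\ is_sum I (fun n => a n *: phi n) s,
      A * fine (sqsum I a) <= ell2_norm s ^+ 2 &
      ell2_norm s ^+ 2 <= B * fine (sqsum I a)]].

End SquareSummable.

(* Main.v *)
(** The finite-dimensional core is the method of Marcus, Spielman and Srivastava,
    in the form of the one-sided pavings of Leake and Ravichandran.  Given a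
    Hermitian matrix [A] and disjoint groups of indices, let [M S] be the sum of
    the principal minors of [diag z - A] over all index sets that consist of a
    fixed set [S] and of one index from each group.  This polynomial has no zero
    with all [z a] in the upper half plane, by induction on the number of groups,
    and it is affine in each variable.  Hence the Rayleigh inequality: the quotient
    [M (a |: S) / M S] does not decrease when [S] shrinks.  A barrier argument,
    which adds the groups one at a time and lowers their coordinates from [t > 1]
    to [t - d < 1], shows that [M set0] and all its derivatives are positive at
    [t - d].  Then some index of the first group has a positive summand, and by the
    Rayleigh inequality all the derivatives of this summand are positive too; going
    on, one obtains a choice of indices on which [A <= t - d].

    If [G] is the Gram matrix of finitely many of the vectors and [B > 1] is a
    Bessel bound, then [1 - G / B] is a positive contraction with diagonal
    [1 - 1 / B < 1].  With [r] copies of it, one for each colour, the choice is a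
    colouring whose classes satisfy [G >= eta], where [r] and [eta] depend on [B]
    only.  By compactness the finite colourings yield a colouring of all the
    indices. *)

Require Import Defs.
From mathcomp Require Import all_boot all_order all_fingroup all_algebra.
From mathcomp Require Import ring.

Set Implicit Arguments.
Unset Strict Implicit.
Unset Printing Implicit Defensive.

Import Order.TTheory GRing.Theory Num.Theory.

Local Open Scope ring_scope.

(** * Sums of principal minors *)

Section MixedMinor.
Variables (K : comNzRingType) (N : nat).
Implicit Types (A : 'M[K]_N) (z : 'I_N -> K) (S : {set 'I_N}) (a b : 'I_N).
Implicit Types (g : seq 'I_N) (T : seq (seq 'I_N)).

(* The rows outside [S] are those of the identity matrix, so that the determinant
   is the principal minor of [diag z - A] on [S]. *)
Definition minor_mx A z S : 'M[K]_N :=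
  \matrix_(a, b) (if a \in S then z a *+ (a == b) - A a b else (a == b)%:R).

Definition pminor A z S : K := \det (minor_mx A z S).

Fixpoint mixed_minor A z S T : K :=
  if T is g :: T' then \sum_(a <- g) mixed_minor A z (a |: S) T'
  else pminor A z S.

Lemma eq_pminor A z z' S : {in S, z =1 z'} -> pminor A z S = pminor A z' S.
Proof.
move=> zz'; congr (\det _); apply/matrixP => a b; rewrite !mxE.
by case: ifP => // /zz' ->.
Qed.

Lemma eq_mixed_minor A z z' S T :
  (forall a, (a \in S) || (a \in flatten T) -> z a = z' a) ->
  mixed_minor A z S T = mixed_minor A z' S T.
Proof.
elim: T S => [|g T IH] S zz' /=.
  by apply: eq_pminor => a aS; apply: zz'; rewrite aS.
rewrite !big_seq; apply: eq_bigr => a ag; apply: IH => b.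
rewrite !inE -orbA => /orP[/eqP->|bST]; apply: zz'.
  by rewrite /= mem_cat ag orbT.
by rewrite /= mem_cat; case/orP: bST => ->; rewrite ?orbT.
Qed.

(** The determinant is linear in row [a]: a change of [z a] adds a multiple of the identity row, and
    with that row in place the determinant is the minor without [a]. *)
Lemma pminor_affine A z z' S a : a \notin S -> (forall b, b != a -> z' b = z b) ->
  pminor A z' (a |: S) = pminor A z (a |: S) + (z' a - z a) * pminor A z S.
Proof.
move=> aS zz'; rewrite /pminor -[X in X + _]mul1r.
apply: (determinant_multilinear (i0 := a)).
- apply/rowP => b; rewrite !mxE (setU11 a S) (negbTE aS) mul1r.
  by case: (a == b); rewrite ?mulr1n ?mulr0n; ring.
- apply/matrixP => b c; rewrite !mxE !inE [lift a b == a]eq_sym (negbTE (neq_lift a b)) /=.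
  by rewrite zz' // eq_sym neq_lift.
- apply/matrixP => b c; rewrite !mxE !inE [lift a b == a]eq_sym (negbTE (neq_lift a b)) /=.
  by rewrite zz' // eq_sym neq_lift.
Qed.

Lemma mixed_minor_affine A z z' S T a :
  a \notin S -> a \notin flatten T -> (forall b, b != a -> z' b = z b) ->
  mixed_minor A z' (a |: S) T =
    mixed_minor A z (a |: S) T + (z' a - z a) * mixed_minor A z S T.
Proof.
elim: T S => [|g T IH] S aS aT zz' /=; first exact: pminor_affine.
move: aT; rewrite /= mem_cat negb_or => /andP[ag aT].
rewrite mulr_sumr -big_split /= !big_seq; apply: eq_bigr => b bg.
rewrite setUCA; apply: IH => //.
rewrite !inE negb_or aS andbT; apply: contraNneq ag => -> //.
Qed.

(** Transposition turns the identity rows of [minor_mx] into columns, so the two matrices are not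
    transposes of each other and their Leibniz sums are compared instead. For Hermitian [A] this
    gives [mixed_minor_conjC]. *)
Lemma mixed_minor_tr A z S T : mixed_minor A^T z S T = mixed_minor A z S T.
Proof.
elim: T S => [|g T IH] S /=; last by apply: eq_bigr => a _; exact: IH.
rewrite /pminor -det_tr; apply: eq_bigr => s _; congr (_ * _).
(* In both Leibniz sums only the permutations fixing the complement of [S]
   contribute. *)
have [/forallP fixS|] := boolP [forall a, (a \notin S) ==> (s a == a)].
  apply: eq_bigr => a _; rewrite !mxE.
  have [aS|aS] := boolP (a \in S); last first.
    move/implyP: (fixS a) => /(_ aS)/eqP sa.
    by rewrite !sa (negbTE aS).
  have -> : s a \in S.
    apply: contraTT aS => saS; move/implyP: (fixS (s a)) => /(_ saS)/eqP.
    by move/perm_inj => {1}<-.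
  by have [->|] := eqVneq (s a) a.
rewrite negb_forall => /existsP[a]; rewrite negb_imply => /andP[aS sa].
rewrite (bigD1 ((s^-1)%g a)) //= [RHS](bigD1 a) //= !mxE permKV (negbTE aS).
rewrite [a == s a]eq_sym (negbTE sa).
have -> : (a == (s^-1)%g a) = false.
  by apply: contraNF sa => /eqP {1}->; rewrite permKV.
by rewrite !mul0r.
Qed.

End MixedMinor.

Lemma map_mixed_minor (K L : comNzRingType) (f : {rmorphism K -> L}) N
  (A : 'M[K]_N) z S T :
  f (mixed_minor A z S T) = mixed_minor (map_mx f A) (f \o z) S T.
Proof.
elim: T S => [|g T IH] S /=; last first.
  by rewrite rmorph_sum; apply: eq_bigr => a _; exact: IH.
rewrite /pminor -det_map_mx; congr (\det _); apply/matrixP => a b.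
rewrite !mxE; case: ifP => _; first by rewrite rmorphB rmorphMn.
by rewrite rmorph_nat.
Qed.

(** * Zero-free half planes *)

Section Limit.
Variable C : numClosedFieldType.
Implicit Types (p q : {poly C}).

Lemma horner_norm_le p (x : C) : 0 <= x <= 1 -> `|p.[x]| <= \sum_(i < size p) `|p`_i|.
Proof.
move=> /andP[x0 x1]; rewrite horner_coef; apply: le_trans (ler_norm_sum _ _ _) _.
apply: ler_sum => i _; rewrite normrM normrX (ger0_norm x0).
by rewrite ler_piMr // exprn_ile1.
Qed.

(** A limit at zero by explicit estimates: [d] measures how far the constant term [c] is from being
    nonnegative, and [d <= 2 k e] for all small [e] forces [d = 0]. *)
Lemma horner_ge0_at0 p : (forall e, 0 < e -> 0 <= p.[e]) -> 0 <= p.[0].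
Proof.
elim/poly_ind: p => [|s c _] pge; first by rewrite horner0.
rewrite hornerMXaddC mulr0 add0r.
have {}pge e : 0 < e -> 0 <= s.[e] * e + c by move=> /pge; rewrite hornerMXaddC.
pose k := \sum_(i < size s) `|s`_i|; pose d := `| `|c| - c|.
have k0 : 0 <= k by apply: sumr_ge0 => i _; exact: normr_ge0.
have dle e : 0 < e -> e <= 1 -> d <= 2%:R * (k * e).
  move=> e0 e1; have y0 := pge e e0; set y := _ + c in y0.
  have cy : `|c - y| <= k * e.
    rewrite distrC /y addrK normrM (gtr0_norm e0) ler_wpM2r ?(ltW e0) //.
    by apply: horner_norm_le; rewrite (ltW e0).
  have -> : d = `| (`|c| - `|y|) + (y - c)| by rewrite /d (ger0_norm y0); congr `|_|; ring.
  apply: le_trans (ler_normD _ _) _; rewrite [2%:R](natrD _ 1 1) mulrDl mul1r.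
  by apply: lerD; [apply: le_trans (ler_dist_dist _ _) _|rewrite distrC].
have d0 : 0 <= d := normr_ge0 _.
have [/eqP|dn0] := eqVneq d 0.
  by rewrite normr_eq0 subr_eq0 => /eqP <-.
have {dn0} dgt0 : 0 < d by rewrite lt_def dn0.
(* The value [e = d / (d + 2 k + 1)] is at most 1 and satisfies [2 k e < d], a contradiction. *)
have den : 0 < d + 2%:R * k + 1 by rewrite ltr_wpDl ?addr_ge0 ?mulr_ge0.
have d1 : d / (d + 2%:R * k + 1) <= 1.
  by rewrite ler_pdivrMr // mul1r -addrA lerDl addr_ge0 ?mulr_ge0.
have := dle _ (divr_gt0 dgt0 den) d1.
rewrite (_ : _ * (k * _) = (d * (2%:R * k)) / (d + 2%:R * k + 1)); last ring.
by rewrite ler_pdivlMr // ler_pM2l // addrAC gerDr lt_geF // ltr_wpDl.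
Qed.

Lemma horner_conj p (e : C) : e \is Num.real -> (p.[e])^* = (map_poly Num.conj p).[e].
Proof. by move=> /CrealP eE; rewrite -[in RHS]eE horner_map. Qed.

(** On the real axis this imaginary part is itself a polynomial, obtained by conjugating
    coefficients, so [horner_ge0_at0] applies to it. *)
Lemma Im_horner_at0 p q :
  (forall e, 0 < e -> 0 <= 'Im (p.[e] * (q.[e])^*)) -> 0 <= 'Im (p.[0] * (q.[0])^*).
Proof.
pose r := ('i / 2%:R) *: (map_poly Num.conj p * q - p * map_poly Num.conj q).
have rE e : e \is Num.real -> r.[e] = 'Im (p.[e] * (q.[e])^*).
  move=> eR; rewrite ImE /r hornerZ hornerD hornerN !hornerM -!horner_conj //.
  by rewrite (rmorphM Num.conj) /= conjCK; ring.
move=> h; rewrite -rE ?real0 //; apply: horner_ge0_at0 => e e0.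
by rewrite rE ?gtr0_real // h.
Qed.

End Limit.

(** * Nonvanishing of the mixed minors in the upper half plane *)

Section Stability.
Variables (C : numClosedFieldType) (N : nat) (A : 'M[C]_N).
Hypothesis hermA : A^T = map_mx Num.conj A.
Implicit Types (x z : 'I_N -> C) (S : {set 'I_N}) (a b : 'I_N).
Implicit Types (g : seq 'I_N) (T : seq (seq 'I_N)).

Local Notation M := (mixed_minor A).

Definition qform (u v : 'I_N -> C) := \sum_a \sum_b (u a)^* * A a b * v b.

Lemma herm_coef a b : (A a b)^* = A b a.
Proof. by move/matrixP: hermA => /(_ a b); rewrite !mxE. Qed.

Lemma qform_conj u v : (qform u v)^* = qform v u.
Proof.
rewrite /qform rmorph_sum exchange_big; apply: eq_bigr => a _.
rewrite rmorph_sum; apply: eq_bigr => b _.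
by rewrite !rmorphM /= conjCK herm_coef; ring.
Qed.

Lemma qform_real u : qform u u \is Num.real.
Proof. by apply/CrealP; rewrite qform_conj. Qed.

Lemma mixed_minor_conjC z S T : (M z S T)^* = M (fun a => (z a)^*) S T.
Proof. by rewrite (map_mixed_minor Num.conj) -hermA mixed_minor_tr. Qed.

Lemma mixed_minor_real x S T : (forall a, x a \is Num.real) -> M x S T \is Num.real.
Proof.
move=> xR; apply/CrealP; rewrite mixed_minor_conjC.
by apply: eq_mixed_minor => a _; apply/CrealP.
Qed.

Definition upper_half z := forall a, 0 < 'Im (z a).

Lemma pminor_ker z S : pminor A z S = 0 ->
  exists2 v : 'I_N -> C, (exists a, v a != 0) &
    (forall a, a \notin S -> v a = 0) /\
    (forall a, a \in S -> z a * v a = \sum_b A a b * v b).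
Proof.
move=> /eqP; rewrite /pminor -det_tr => /det0P[v vn0 vX].
exists (v 0).
  by have /rV0Pn[a va] := vn0; exists a.
have E a : \sum_b v 0 b * minor_mx A z S a b = 0.
  have : (v *m (minor_mx A z S)^T) 0 a = 0 by rewrite vX mxE.
  by rewrite mxE => E; apply: etrans E; apply: eq_bigr => b _; rewrite [in RHS]mxE.
split=> a aS; have := E a.
  rewrite (bigD1 a) //= big1 => [|b ba]; rewrite !mxE (negbTE aS).
    by rewrite eqxx mulr1 addr0.
  by rewrite eq_sym (negbTE ba) mulr0.
move=> /eqP; rewrite (eq_bigr (fun b => z a *+ (a == b) * v 0 b - A a b * v 0 b)).
  rewrite big_split /= sumrN subr_eq0 => /eqP <-.
  rewrite (bigD1 a) //= big1 => [|b ba]; first by rewrite eqxx addr0.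
  by rewrite eq_sym (negbTE ba) mul0r.
by move=> b _; rewrite mxE aS mulrC mulrBl.
Qed.

(** A kernel vector [v] would make the sum of [z a * |v a| ^+ 2] equal to the real number
    [qform v v], although its imaginary part is positive. *)
Lemma pminor_neq0 z S : upper_half z -> pminor A z S != 0.
Proof.
move=> zU; apply/eqP => /pminor_ker[v [c vc] [v0 vE]].
have Q : \sum_a z a * `|v a| ^+ 2 = qform v v.
  apply: eq_bigr => a _; have [aS|aS] := boolP (a \in S).
    rewrite normCK mulrA vE // mulr_suml; apply: eq_bigr => b _; ring.
  rewrite v0 // normr0 expr0n mulr0 big1 // => b _.
  by rewrite conjC0 !mul0r.
have : 'Im (qform v v) = 0 by apply/Creal_ImP; exact: qform_real.
rewrite -Q raddf_sum (bigD1 c) //=.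
have nR a : `|v a| ^+ 2 \is Num.real by rewrite rpredX // normr_real.
move/eqP; rewrite addr_eq0 => /eqP E.
have : 0 < 'Im (z c * `|v c| ^+ 2) by rewrite ImMr // mulr_gt0 ?zU // exprn_gt0 // normr_gt0.
rewrite E oppr_gt0 => /lt_geF/negP[].
by apply: sumr_ge0 => a _; rewrite ImMr // mulr_ge0 ?(ltW (zU _)) // exprn_ge0.
Qed.

(** Groups have to be nonempty, since a sum over an empty group vanishes. *)
Definition admissible S T := [&& uniq (flatten T), all (fun a => a \notin S) (flatten T)
  & all (fun g => g != [::]) T].

Lemma admissible_cons S g T a : admissible S (g :: T) -> a \in g ->
  [/\ a \notin S, a \notin flatten T, admissible S T & admissible (a |: S) T].
Proof.
rewrite /admissible /= cat_uniq all_cat => /and3P[/and3P[ug ugT uT] /andP[gS TS] /andP[g0 T0]] ag.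
have aT : a \notin flatten T.
  by apply: contra ugT => aT; apply/hasP; exists a.
split=> //; [exact: (allP gS)|by apply/and3P; split|].
apply/and3P; split=> //; apply/allP => b bT; rewrite !inE negb_or (allP TS) // andbT.
by apply: contraNneq aT => <-.
Qed.

Lemma admissible_sub S S' T : S' \subset S -> admissible S T -> admissible S' T.
Proof.
move=> sS /and3P[uT TS T0]; apply/and3P; split=> //.
by apply/allP => a /(allP TS); apply: contra; exact: (subsetP sS).
Qed.

(** By affinity in [z a], the minor on [a |: S] vanishes once [z a] is replaced by [z a] minus the
    quotient; that point must therefore lie outside the upper half plane. *)
Lemma mixed_minor_ratio z S T a : upper_half z -> a \notin S -> a \notin flatten T ->
  (forall z', upper_half z' -> M z' (a |: S) T != 0) -> M z S T != 0 ->
  'Im (z a) <= 'Im (M z (a |: S) T / M z S T).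
Proof.
move=> zU aS aT nz nz0; rewrite real_leNgt ?Creal_Im //; apply/negP => lt.
pose s := z a - M z (a |: S) T / M z S T.
have sU : upper_half (fun b => if b == a then s else z b).
  by move=> b; case: eqP => // _; rewrite /s raddfB /= subr_gt0.
have /eqP := nz _ sU; apply.
rewrite (@mixed_minor_affine _ _ A z) // => [|b ba]; last by rewrite (negbTE ba).
by rewrite eqxx /s addrAC subrr add0r mulNr divfK // subrr.
Qed.

(** Induction on the groups: divided by [M z S T], which is nonzero by induction, every summand has
    positive imaginary part by [mixed_minor_ratio], hence so has the sum. *)
Lemma mixed_minor_neq0 z S T : admissible S T -> upper_half z -> M z S T != 0.
Proof.
elim: T z S => [|g T IH] z S w zU /=; first exact: pminor_neq0.
have [g0] : exists a, a \in g.
  by case/and3P: w => _ _ /=; case: g => // b g' _; exists b; rewrite mem_head.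
move=> gg; have wT : admissible S T by have [] := admissible_cons w gg.
have nS := IH z S wT zU; apply/eqP => s0.
have : 'Im (\sum_(a <- g) (M z (a |: S) T / M z S T)) = 0.
  by rewrite -mulr_suml s0 mul0r raddf0.
have gt a : a \in g -> 0 < 'Im (M z (a |: S) T / M z S T).
  move=> ag; have [aS aT _ w'] := admissible_cons w ag.
  apply: lt_le_trans (zU a) _; apply: mixed_minor_ratio => // z'; exact: IH.
rewrite raddf_sum /= => /eqP; rewrite big_seq psumr_eq0.
  by move=> /allP /(_ _ gg); rewrite gg /= (gt_eqF (gt _ gg)).
by move=> a ag; rewrite ltW ?gt.
Qed.

(** The form of [mixed_minor_ratio] for the closed half plane, free of division: all coordinates are
    moved up by ['i * e], and [e] tends to zero. *)
Lemma mixed_minor_Im z S T a : a \notin S -> a \notin flatten T ->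
  admissible (a |: S) T -> (forall b, 0 <= 'Im (z b)) ->
  0 <= 'Im ((M z (a |: S) T - z a * M z S T) * (M z S T)^*).
Proof.
move=> aS aT w z0; have w' : admissible S T by apply: admissible_sub w; exact: subsetUr.
pose Z b : {poly C} := (z b)%:P + 'i *: 'X.
pose P S' := mixed_minor (map_mx polyC A) Z S' T.
have ZE e b : (Z b).[e] = z b + 'i * e by rewrite !hornerE.
have PE e S' : (P S').[e] = M (fun b => z b + 'i * e) S' T.
  have := map_mixed_minor (horner_eval e) (map_mx polyC A) Z S' T.
  rewrite /= /horner_eval => ->; rewrite -map_mx_comp (_ : map_mx _ A = A).
    by apply: eq_mixed_minor => b _; rewrite /= ZE.
  by apply/matrixP => b c; rewrite !mxE /= hornerC.
have Z0 S' : M (fun b => z b + 'i * 0) S' T = M z S' T.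
  by apply: eq_mixed_minor => b _; rewrite mulr0 addr0.
have := @Im_horner_at0 C (P (a |: S) - Z a * P S) (P S).
rewrite hornerD hornerN hornerM !PE !Z0 ZE mulr0 addr0; apply=> e e0.
rewrite hornerD hornerN hornerM !PE ZE; set z' := fun b => _.
have zU : upper_half z'.
  move=> b; rewrite raddfD /= ImMr ?gtr0_real // Im_i mul1r.
  by rewrite ltr_wpDl.
have nS := mixed_minor_neq0 w' zU.
have := mixed_minor_ratio zU aS aT (fun y => mixed_minor_neq0 w) nS.
rewrite -subr_ge0 -raddfB /= => h.
have -> : (M z' (a |: S) T - (z a + 'i * e) * M z' S T) * (M z' S T)^* =
  (M z' (a |: S) T / M z' S T - z' a) * `|M z' S T| ^+ 2.
  by rewrite normCK mulrA; congr (_ * _); rewrite mulrBl divfK.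
by rewrite ImMr ?rpredX ?normr_real // mulr_ge0 // exprn_ge0.
Qed.

End Stability.

(** * Interlacing polynomials *)

Section Interlacing.
Variable C : numClosedFieldType.
Implicit Types (p q g h : {poly C}) (s : seq C).

Definition rootpoly s : {poly C} := \prod_(m <- s) ('X - m%:P).

Lemma size_rootpoly s : size (rootpoly s) = (size s).+1.
Proof. exact: size_prod_XsubC. Qed.

Lemma rootpoly_rem s l : l \in s -> rootpoly s = ('X - l%:P) * rootpoly (rem l s).
Proof. by move=> ls; rewrite /rootpoly (perm_big _ (perm_to_rem ls)) big_cons. Qed.

Lemma lagrange_rootpoly s h : uniq s -> (size h <= size s)%N ->
  h = \sum_(l <- s) (h.[l] / (rootpoly (rem l s)).[l]) *: rootpoly (rem l s).
Proof.
move=> us sh; apply/eqP; rewrite -subr_eq0; apply/eqP.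
apply: (@roots_geq_poly_eq0 _ _ s) => //.
  apply/allP => m ms; rewrite rootE hornerD hornerN (perm_big _ (perm_to_rem ms)) /=.
  rewrite big_cons hornerD hornerZ divfK; last first.
    by rewrite -rootE root_prod_XsubC mem_rem_uniq // !inE eqxx.
  rewrite horner_sum big_seq big1 ?addr0 ?subrr // => l.
  rewrite mem_rem_uniq // !inE => /andP[lm ls]; apply/eqP.
  rewrite hornerZ mulf_eq0 -rootE root_prod_XsubC mem_rem_uniq // !inE ms andbT.
  by rewrite [m == l]eq_sym lm orbT.
apply: leq_trans (size_polyD _ _) _; rewrite geq_max sh size_polyN.
apply: leq_trans (size_sum _ _ _) _.
rewrite big_seq; elim/big_ind: _ => // [a b|l ls]; first by rewrite geq_max => -> ->.
apply: leq_trans (size_scale_leq _ _) _; rewrite size_rootpoly size_rem //.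
by case: s ls {us sh}.
Qed.

Lemma rootpoly_filter s l :
  rootpoly s = ('X - l%:P) ^+ count_mem l s * rootpoly [seq m <- s | m != l].
Proof.
elim: s => [|m s IH] /=; first by rewrite mul1r.
rewrite {1}/rootpoly big_cons -/(rootpoly s) IH.
have [->|_] /= := eqVneq m l; first by rewrite exprS mulrA.
by rewrite add0n /rootpoly big_cons mulrCA.
Qed.

(* [g / q] maps the upper half plane to the closed lower half plane, without the
   division. *)
Definition nevanlinna g q := forall u : C, 0 < 'Im u -> 'Im (g.[u] * (q.[u])^*) <= 0.

Lemma nevanlinna_closed g q u : nevanlinna g q -> 0 <= 'Im u -> 'Im (g.[u] * (q.[u])^*) <= 0.
Proof.
move=> gq u0; pose k := u%:P + 'i *: 'X.
have kE e : k.[e] = u + e * 'i by rewrite !hornerE mulrC.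
have := @Im_horner_at0 C (- (g \Po k)) (q \Po k).
rewrite hornerN !horner_comp !kE mul0r addr0 mulNr raddfN /= oppr_ge0.
apply=> e e0; rewrite hornerN !horner_comp kE mulNr raddfN /= oppr_ge0.
by apply: gq; rewrite raddfD /= ImMl ?gtr0_real // Im_i mulr1 ltr_wpDl.
Qed.

(** The leading behaviour at [l] along the ray [l + e * w]: the positive factor [e ^+ m] is divided
    out before [e] tends to zero. *)
Lemma nevanlinna_local g q l m (w : C) : nevanlinna g (('X - l%:P) ^+ m * q) ->
  l \is Num.real -> 0 <= 'Im w -> 'Im (g.[l] * (q.[l])^* * (w^*) ^+ m) <= 0.
Proof.
move=> gq lR w0; pose k := l%:P + w *: 'X.
have kE e : k.[e] = l + e * w by rewrite !hornerE mulrC.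
have := @Im_horner_at0 C (- (g \Po k)) (w ^+ m *: (q \Po k)).
rewrite hornerN hornerZ !horner_comp !kE mul0r addr0.
rewrite rmorphM rmorphXn /= mulNr raddfN /= oppr_ge0 [_ ^+ m * _]mulrC mulrA.
apply=> e e0; rewrite hornerN hornerZ !horner_comp kE mulNr raddfN /= oppr_ge0.
have eR : e \is Num.real by rewrite gtr0_real.
have : 0 <= 'Im (l + e * w).
  by rewrite raddfD /= (Creal_ImP _ lR) add0r ImMl // mulr_ge0 // ltW.
move=> /(nevanlinna_closed gq); rewrite hornerM horner_exp hornerXsubC addrAC subrr add0r.
rewrite exprMn -mulrA (rmorphM Num.conj) (rmorphXn Num.conj) /= (CrealP eR) mulrCA ImMl ?rpredX //.
by rewrite pmulr_rle0 // exprn_gt0.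
Qed.

(** At a root of multiplicity two or more the leading term turns by a full half circle or more as
    [w] runs over the upper half plane, so it cannot stay in the lower one. At a simple root the
    sign condition forces a nonnegative residue. *)
Lemma nevanlinna_simple_roots g s : (forall l, l \in s -> l \is Num.real) ->
  nevanlinna g (rootpoly s) -> ~~ has (root g) s ->
  uniq s /\ forall l, l \in s -> 0 <= g.[l] / (rootpoly (rem l s)).[l].
Proof.
move=> sR gs nr.
have loc l : l \in s -> let Q := rootpoly [seq m <- s | m != l] in
    Q.[l] != 0 /\ forall w, 0 <= 'Im w -> 'Im (g.[l] * (Q.[l])^* * (w^*) ^+ count_mem l s) <= 0.
  move=> ls Q; split; first by rewrite -rootE root_prod_XsubC mem_filter eqxx.
  by move=> w w0; apply: nevanlinna_local w0 => //; [rewrite -rootpoly_filter|exact: sR].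
have gl0 l : l \in s -> g.[l] != 0 by move=> ls; apply: contra nr => g0; apply/hasP; exists l.
have us : uniq s.
  apply: count_mem_uniq => l; have [ls|ls] := boolP (l \in s); last exact/count_memPn.
  apply/eqP; rewrite eqn_leq -has_count has_pred1 ls andbT leqNgt; apply/negP => c2.
  have [Q0 QI] := loc l ls.
  set c := g.[l] * _ in QI; have c0 : c != 0 by rewrite mulf_neq0 ?gl0 // conjC_eq0.
  (* a direction [w] in which [c * (w^* ) ^+ m] is a positive multiple of ['i] *)
  have := QI _ (Im_rootC_ge0 (- ('i * c)) c2).
  rewrite -rmorphXn rootCK ?(ltnW c2) // rmorphN rmorphM /= conjCi mulNr opprK.
  rewrite mulrCA -normCK ImMr ?rpredX ?normr_real // Im_i mul1r.
  by apply/negP; rewrite lt_geF // exprn_gt0 // normr_gt0.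
split=> // l ls; have [] := loc l ls; rewrite -rem_filter // count_uniq_mem // ls.
set Q := rootpoly _ => Q0 QI.
have -> : g.[l] / Q.[l] = (g.[l] * (Q.[l])^*) / `|Q.[l]| ^+ 2.
  by rewrite normCK invfM mulrACA divff ?mulr1 // conjC_eq0.
rewrite divr_ge0 ?exprn_ge0 //; set c := _ * _ in QI *.
(* The directions [1] and [-1] show that [c] is real, the direction ['i] that it is nonnegative. *)
have Im1 : 'Im (1 : C) = 0 by apply/Creal_ImP; exact: rpred1.
have := QI 1; rewrite Im1 lexx expr1 conjC1 mulr1 => /(_ isT) I1.
have := QI (-1); rewrite raddfN /= Im1 oppr0 lexx expr1 rmorphN /= conjC1 mulrN1.
rewrite raddfN /= oppr_le0 => /(_ isT) I2.
have cR : c \is Num.real by apply/Creal_ImP/eqP; rewrite eq_le I1.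
have := QI 'i; rewrite Im_i ler01 expr1 conjCi ImMl // raddfN /= Im_i mulrN1 oppr_le0.
by apply.
Qed.

(* Up to a multiple of [rootpoly s], [g] is a combination of the [rootpoly (rem l s)]
   with nonnegative coefficients, the residues of [g / rootpoly s]; stating this
   through linear functionals makes the cancellation of common roots immediate. *)
Lemma nevanlinna_cone n (L : {poly C} -> C) s g : (size s <= n)%N ->
  (forall p q, L (p + q) = L p + L q) -> (forall c p, L (c *: p) = c * L p) ->
  (forall l, l \in s -> l \is Num.real) -> (size g <= (size s).+1)%N ->
  nevanlinna g (rootpoly s) -> L (rootpoly s) = 0 ->
  (forall l, l \in s -> 0 <= L (rootpoly (rem l s))) -> 0 <= L g.
Proof.
elim: n L s g => [|n IH] L s g sn LD LZ sR sg gs L0 Lr.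
  have s0 : s = [::] by apply/nilP; rewrite /nilp -leqn0.
  move: sg L0; rewrite s0 => /size1_polyC ->.
  by rewrite /rootpoly big_nil -alg_polyC LZ => ->; rewrite mulr0.
have LL0 : L 0 = 0 by have := LZ 0 0; rewrite scale0r mul0r.
have [/hasP[l ls rl]|nr] := boolP (has (root g) s).
  have [g1 gE] := factor_theorem _ _ rl; rewrite mulrC in gE; rewrite gE.
  have ss : size s = (size (rem l s)).+1 by rewrite size_rem // prednK //; case: (s) ls.
  have mR m : m \in rem l s -> m \is Num.real by move/mem_rem; exact: sR.
  have [->|g1n0] := eqVneq g1 0; first by rewrite mulr0 LL0.
  apply: (IH (fun p => L (('X - l%:P) * p)) (rem l s)) => //.
  - by rewrite -ltnS -ss.
  - by move=> p q; rewrite mulrDr LD.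
  - by move=> c p; rewrite -scalerAr LZ.
  - by move: sg; rewrite gE size_monicM ?monicXsubC // size_XsubC /= ss ltnS.
  - move=> u u0; have := gs u u0; rewrite gE (rootpoly_rem ls) !hornerM hornerXsubC.
    rewrite (rmorphM Num.conj) mulrACA -normCK ImMl ?rpredX ?normr_real // pmulr_rle0 //.
    rewrite exprn_gt0 // normr_gt0 subr_eq0; apply: contraTneq u0 => ->.
    by rewrite (Creal_ImP _ (sR l ls)) ltxx.
  - by rewrite -rootpoly_rem.
  move=> m ml; have ms := mem_rem ml; have := Lr m ms.
  suff -> : rootpoly (rem m s) = ('X - l%:P) * rootpoly (rem m (rem l s)) by [].
  have /(congr1 (fun p => p %/ ('X - m%:P))) : rootpoly s = rootpoly s by [].
  rewrite {1}(rootpoly_rem ms) (rootpoly_rem ls) (rootpoly_rem ml).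
  by rewrite mulrCA !mulKp // polyXsubC_eq0.
have [us res] := nevanlinna_simple_roots sR gs nr.
(* As [rootpoly s] is monic, subtracting [c] times it cancels the top coefficient, and Lagrange
   interpolation at the simple roots applies to [h]. *)
pose c := g`_(size s); pose h := g - c *: rootpoly s.
have sh : (size h <= size s)%N.
  apply/leq_sizeP => j; rewrite leq_eqVlt => /predU1P[<-|lt]; rewrite coefB coefZ.
    have := monic_prod_XsubC s (fun=> true) id.
    rewrite /c monicE lead_coefE size_prod_XsubC /= => /eqP ->.
    by rewrite mulr1 subrr.
  by rewrite !nth_default ?size_rootpoly ?mulr0 ?subr0 // (leq_trans sg).
have -> : L g = L h by rewrite /h -scaleNr LD LZ L0 mulr0 addr0.
have hg l : l \in s -> h.[l] = g.[l].
  by move=> ls; rewrite hornerD hornerN hornerZ (rootpoly_rem ls) hornerM hornerXsubC subrr mul0r mulr0 subr0.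
rewrite (lagrange_rootpoly us sh) big_seq.
elim/big_ind: _ => [|a b|l ls]; first by rewrite LL0.
  by rewrite LD; exact: addr_ge0.
by rewrite LZ hg // mulr_ge0 ?res ?Lr.
Qed.

End Interlacing.

(** * The Rayleigh inequality *)

Lemma am_hm (F : numFieldType) (t : seq F) (c : F) : 0 < c ->
  (forall y, y \in t -> 0 < y) -> \sum_(y <- t) y^-1 <= c ->
  (size t)%:R ^+ 2 / c <= \sum_(y <- t) y.
Proof.
move=> c0 t0 tc; pose k : F := (size t)%:R / c.
have k0 : 0 <= k by rewrite divr_ge0 ?ler0n ?ltW.
(* [(y - k) ^+ 2 >= 0] gives [y >= 2 k - k ^+ 2 / y] *)
have : \sum_(y <- t) (2%:R * k - k ^+ 2 * y^-1) <= \sum_(y <- t) y.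
  rewrite !big_seq; apply: ler_sum => y yt; have y0 := t0 y yt.
  rewrite -subr_ge0 (_ : _ - _ = (y - k) ^+ 2 / y); last by field; rewrite gt_eqF.
  by rewrite divr_ge0 ?(ltW y0) // -realEsqr rpredB ?ger0_real ?(ltW y0).
rewrite big_split /= sumrN -[X in _ - X]mulr_sumr big_const_seq count_predT iter_addr_0.
apply: le_trans; rewrite -[_ * _ *+ size t]mulr_natr lerBrDr.
apply: le_trans (_ : (size t)%:R ^+ 2 / c + k ^+ 2 * c <= _).
  by rewrite lerD2l ler_wpM2l ?exprn_ge0.
by rewrite le_eqVlt; apply/orP; left; apply/eqP; rewrite /k; field; rewrite gt_eqF.
Qed.

Lemma deriv_rootpoly (C : numClosedFieldType) (s : seq C) (w : C) : w \notin s ->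
  (rootpoly s)^`().[w] = (rootpoly s).[w] * \sum_(l <- s) (w - l)^-1.
Proof.
elim: s => [|l s IH]; first by rewrite /rootpoly !big_nil derivC hornerC mulr0.
rewrite inE negb_or => /andP[wl ws]; rewrite {1 2}/rootpoly !big_cons -/(rootpoly s).
rewrite derivM derivXsubC hornerD !hornerM !hornerXsubC hornerC IH //.
by field; rewrite subr_eq0.
Qed.

Section Rayleigh.
Variables (C : numClosedFieldType) (N : nat) (A : 'M[C]_N).
Hypothesis hermA : A^T = map_mx Num.conj A.
Implicit Types (x z : 'I_N -> C) (S : {set 'I_N}) (a b : 'I_N).
Implicit Types (g : seq 'I_N) (T : seq (seq 'I_N)).

Local Notation M := (mixed_minor A).

Definition update x g (s : C) b := if b \in g then s else x b.

Definition real_point x := forall a, x a \is Num.real.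

Lemma real_point_update x g s : real_point x -> s \is Num.real -> real_point (update x g s).
Proof. by move=> xR sR a; rewrite /update; case: ifP. Qed.

Lemma update_affine x s S T a : a \notin S -> a \notin flatten T ->
  M (update x [:: a] s) (a |: S) T = M x (a |: S) T + (s - x a) * M x S T.
Proof.
move=> aS aT; rewrite (@mixed_minor_affine _ _ A x) // /update => [|b /negbTE ba].
  by rewrite inE eqxx.
by rewrite inE ba.
Qed.

Lemma update_out x g s S T : {in g, forall a, a \notin S /\ a \notin flatten T} ->
  M (update x g s) S T = M x S T.
Proof.
move=> gST; apply: eq_mixed_minor => b bST; rewrite /update; case: ifP => // /gST[bS bT].
by move: bST; rewrite (negbTE bS) (negbTE bT).
Qed.

(** Only the coordinate [b] leaves the real axis, by ['i]. Affinity in [b] makes every term of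
    [mixed_minor_Im] explicit, and the imaginary part is the difference of the two sides. *)
Lemma rayleigh x S T a b : real_point x -> a != b -> a \notin S -> b \notin S ->
  a \notin flatten T -> admissible (a |: (b |: S)) T ->
  M x (a |: (b |: S)) T * M x S T <= M x (a |: S) T * M x (b |: S) T.
Proof.
move=> xR ab aS bS aT w.
have bT : b \notin flatten T.
  by case/and3P: w => _ /allP h _; apply/negP => /h; rewrite !inE eqxx orbT.
pose z := update x [:: b] (x b + 'i).
have abS : a \notin b |: S by rewrite !inE negb_or ab.
have baS : b \notin a |: S by rewrite !inE negb_or eq_sym ab.
have z0 c : 0 <= 'Im (z c).
  rewrite /z /update; case: ifP => _; last by rewrite (Creal_ImP _ (xR c)).
  by rewrite raddfD /= (Creal_ImP _ (xR b)) add0r Im_i.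
have := mixed_minor_Im hermA abS aT w z0.
rewrite {2}/z /update inE (negbTE ab) setUCA !update_affine // [x b + 'i]addrC addrK.
have := mixed_minor_real hermA (b |: (a |: S)) T xR.
have := mixed_minor_real hermA (a |: S) T xR.
have := mixed_minor_real hermA (b |: S) T xR.
have := mixed_minor_real hermA S T xR.
move: (M x (b |: (a |: S)) T) (M x (a |: S) T) (M x (b |: S) T) (M x S T).
move=> P Q R W WR RR QR PR; move: (xR a); move: (x a) => y yR.
rewrite rmorphD rmorphM /= conjCi (CrealP WR) (CrealP RR).
have -> : (P + 'i * Q - y * (R + 'i * W)) * (R + - 'i * W) =
   ((P - y * R) * R - 'i ^+ 2 * (Q - y * W) * W) + 'i * (Q * R - P * W) by ring.
by rewrite sqrCi Im_rect ?subr_ge0 ?(rpredB, rpredM, rpredN, rpred1).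
Qed.

(* The minors for the subsets of [S] are the derivatives with respect to the
   variables in [S], so the condition says that [x] lies above the zeros. *)
Definition minors_pos x S T := forall S', S' \subset S -> 0 < M x S' T.

Lemma minors_posS x S S' T : S' \subset S -> minors_pos x S T -> minors_pos x S' T.
Proof. by move=> sS xP S2 sS2; apply: xP; exact: subset_trans sS. Qed.

(** The elements of [S] outside [S'] are removed one at a time by [rayleigh]; positivity of the
    intermediate minors allows them to be cancelled. *)
Lemma ratio_mono x S S' T a : real_point x -> a \notin S -> a \notin flatten T ->
  admissible (a |: S) T -> minors_pos x S T -> S' \subset S ->
  M x (a |: S) T * M x S' T <= M x (a |: S') T * M x S T.
Proof.
move=> xR aS aT w xP; move En: #|S :\: S'| => n.
elim: n S aS w xP En => [|n IH] S aS w xP En sS.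
  suff -> : S = S' by [].
  by apply/eqP; rewrite eqEsubset sS andbT -setD_eq0 -cards_eq0 En.
have /card_gt0P[b] : (0 < #|S :\: S'|)%N by rewrite En.
rewrite inE => /andP[bS' bS].
have ss : S :\ b \subset S by exact: subD1set.
have sS' : S' \subset S :\ b by rewrite subsetD1 sS.
have aSb : a \notin S :\ b by apply: contra aS; exact: (subsetP ss).
have ab : a != b by apply: contraNneq aS => ->.
have h1 : M x (a |: S) T * M x (S :\ b) T <= M x (a |: (S :\ b)) T * M x S T.
  have := @rayleigh x (S :\ b) T a b xR ab aSb; rewrite !setD1K //.
  by apply=> //; rewrite !inE eqxx.
have h2 : M x (a |: (S :\ b)) T * M x S' T <= M x (a |: S') T * M x (S :\ b) T.
  apply: IH => //.
  - by apply: admissible_sub w; exact: setUS.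
  - exact: minors_posS xP.
  apply/eqP; rewrite -eqSS -En [in X in _ == X](cardsD1 b) !inE bS bS' add1n eqSS.
  by rewrite setDDl setUC -setDDl eqxx.
rewrite -(ler_pM2r (xP _ ss)) mulrAC; apply: le_trans (ler_wpM2r _ h1) _.
  exact/ltW/xP.
rewrite mulrAC [X in _ <= X]mulrAC; apply: ler_wpM2r h2; exact/ltW/xP.
Qed.

(** Coordinates are raised one at a time: by affinity each raise adds a nonnegative multiple of a
    positive minor. *)
Lemma minors_pos_update x g S T s : real_point x -> minors_pos x S T -> (forall a, a \in g -> x a <= s) ->
  (forall a, a \in g -> a \notin flatten T) -> minors_pos (update x g s) S T.
Proof.
move=> xR xP; elim: g => [|a g IH] xs gT S' sS; first by rewrite (_ : M _ _ _ = M x S' T) ?xP // update_out.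
pose y := update x g s.
have yP : minors_pos y S T by apply: IH => b bg; [apply: xs|apply: gT]; rewrite inE bg orbT.
have E S2 : M (update x (a :: g) s) S2 T = M (update y [:: a] s) S2 T.
  apply: eq_mixed_minor => b _; rewrite /y /update !inE.
  by case: eqP.
have aT : a \notin flatten T by apply: gT; rewrite mem_head.
rewrite E; have [aS|aS] := boolP (a \in S'); last first.
  by rewrite update_out ?yP // => b; rewrite inE => /eqP ->.
rewrite -(setD1K aS) update_affine // ?inE ?eqxx // setD1K //.
apply: ltr_wpDr; last exact: yP.
apply: mulr_ge0; last by apply/ltW/yP/(subset_trans (subD1set _ _)).
rewrite subr_ge0 /y /update; case: ifP => // _; by apply: xs; rewrite mem_head.
Qed.

Lemma mixed_minor_shift x g S T a s w : real_point x -> a \in g -> x a = w ->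
  (forall b, b \in g -> b \notin S /\ b \notin flatten T) ->
  M (update x g s) (a |: S) T = M x (a |: S) T + (s - w) * M x S T.
Proof.
move=> xR ag xa gST; have [aS aT] := gST a ag.
rewrite -xa -update_affine //; apply: eq_mixed_minor => b; rewrite /update !inE -orbA.
by case: eqVneq => [->|_] /=; rewrite ?ag //; case: ifP => // /gST[/negbTE-> /negbTE->].
Qed.

(** If the minor on [a |: S] were zero, [mixed_minor_Im] would bound the positive number
    ['Im (z a) * |M z S T| ^+ 2] above by zero. *)
Lemma mixed_minor_root z S T a : a \notin S -> a \notin flatten T ->
  admissible (a |: S) T -> (forall b, 0 <= 'Im (z b)) -> 0 < 'Im (z a) ->
  M z S T != 0 -> M z (a |: S) T != 0.
Proof.
move=> aS aT w z0 za nz; apply/eqP => E.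
have := mixed_minor_Im hermA aS aT w z0; rewrite E add0r mulNr -mulrA -normCK.
rewrite raddfN /= ImMr ?rpredX ?normr_real // oppr_ge0 => /le_gtF/negP[].
by rewrite mulr_gt0 // exprn_gt0 // normr_gt0.
Qed.

End Rayleigh.

(** * The barrier argument *)

Section Barrier.
Variables (C : numClosedFieldType) (N : nat) (A : 'M[C]_N).
Hypothesis hermA : A^T = map_mx Num.conj A.
Implicit Types (x z : 'I_N -> C) (S : {set 'I_N}) (a b : 'I_N).
Implicit Types (g U : seq 'I_N) (T : seq (seq 'I_N)).

Local Notation M := (mixed_minor A).

(** Restricting the coordinates in [U] to a diagonal gives a univariate polynomial, to which the
    interlacing results apply. *)
Definition pmixed x U S T : {poly C} :=
  mixed_minor (map_mx polyC A) (fun b => if b \in U then 'X else (x b)%:P) S T.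

Lemma horner_pmixed x U S T s : (pmixed x U S T).[s] = M (update x U s) S T.
Proof.
have := map_mixed_minor (horner_eval s) (map_mx polyC A)
  (fun b => if b \in U then 'X else (x b)%:P) S T.
rewrite /= /horner_eval => ->; rewrite -map_mx_comp (_ : map_mx _ A = A).
  apply: eq_mixed_minor => b _; rewrite /update /=.
  by case: ifP => _; rewrite ?hornerX ?hornerC.
by apply/matrixP => b c; rewrite !mxE /= hornerC.
Qed.

Lemma pmixed_nil x S T : pmixed x [::] S T = (M x S T)%:P.
Proof. by rewrite (map_mixed_minor polyC). Qed.

Lemma pmixed_out x a U S T : a \notin S -> a \notin flatten T ->
  pmixed x (a :: U) S T = pmixed x U S T.
Proof.
move=> aS aT; apply: eq_mixed_minor => b; rewrite inE.
by case: eqP => [->|//]; rewrite (negbTE aS) (negbTE aT).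
Qed.

Lemma pmixed_cons x a U S T : a \notin S -> a \notin flatten T -> a \notin U ->
  pmixed x (a :: U) (a |: S) T =
    pmixed (update x [:: a] 0) U (a |: S) T + 'X * pmixed x U S T.
Proof.
move=> aS aT aU; rewrite /pmixed.
rewrite (@mixed_minor_affine _ _ _ (fun b => if b \in U then 'X else (update x [:: a] 0 b)%:P)) //.
  rewrite inE eqxx (negbTE aU) /update !inE eqxx subr0; congr (_ + _ * _).
  apply: eq_mixed_minor => b; rewrite !inE; case: (eqVneq b a) => [->|//].
  by rewrite (negbTE aS) (negbTE aT).
by move=> b ba; rewrite /update !inE (negbTE ba).
Qed.

Lemma set_consU a U S : [set b in a :: U] :|: S = a |: ([set b in U] :|: S).
Proof. by apply/setP => b; rewrite !inE orbA. Qed.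

Definition fresh U S T := uniq U && all (fun a => (a \notin S) && (a \notin flatten T)) U.

Lemma fresh_cons a U S T : fresh (a :: U) S T ->
  [/\ a \notin U, a \notin S, a \notin flatten T, fresh U S T & fresh U (a |: S) T].
Proof.
case/andP => /= /andP[aU uU] /andP[/andP[aS aT] h]; split=> //; first by rewrite /fresh uU.
rewrite /fresh uU; apply/allP => b bU; have /andP[bS ->] := allP h b bU.
by rewrite !inE negb_or bS !andbT; apply: contraNneq aU => <-.
Qed.

Lemma pmixed_size x U S T : fresh U S T ->
  (size (pmixed x U ([set b in U] :|: S) T) <= (size U).+1)%N /\
  (pmixed x U ([set b in U] :|: S) T)`_(size U) = M x S T.
Proof.
elim: U x S => [|a U IH] x S f.
  have -> : [set b in [::]] :|: S = S by apply/setP => b; rewrite !inE.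
  by rewrite pmixed_nil coefC size_polyC; case: (_ != 0).
have [aU aS aT fU faU] := fresh_cons f.
have aUS : a \notin [set b in U] :|: S by rewrite !inE negb_or aU.
rewrite set_consU pmixed_cons //; rewrite [in X in pmixed _ U X T]setUCA.
have [s1 c1] := IH (update x [:: a] 0) _ faU; have [s2 c2] := IH x _ fU; split.
  apply: leq_trans (size_polyD _ _) _; rewrite geq_max; apply/andP; split.
    exact: leq_trans s1 _.
  have [->|p0] := eqVneq (pmixed x U ([set b in U] :|: S) T) 0; first by rewrite mulr0 size_poly0.
  by rewrite mulrC size_mulX.
by rewrite coefD coefXM /= c2 nth_default ?add0r.
Qed.

(** The factor ['X] shifts the index, so that the coefficient of degree [size U - 1] also makes
    sense, as zero, for empty [U]. *)
Lemma pmixed_coef x U S T : fresh U S T ->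
  ('X * pmixed x U ([set b in U] :|: S) T)`_(size U) =
    \sum_(a <- U) M (update x [:: a] 0) (a |: S) T.
Proof.
elim: U x S => [|a U IH] x S f; first by rewrite big_nil coefXM.
have [aU aS aT fU faU] := fresh_cons f.
have aUS : a \notin [set b in U] :|: S by rewrite !inE negb_or aU.
rewrite coefXM /= set_consU pmixed_cons // [in X in pmixed _ U X T]setUCA.
by rewrite coefD IH // (pmixed_size (update x [:: a] 0) faU).2 big_cons.
Qed.

(** Chain rule along the diagonal: the partial derivative in the coordinate [a] deletes [a] from the
    index set. *)
Lemma deriv_pmixed x U S T : fresh U S T ->
  (pmixed x U ([set b in U] :|: S) T)^`() =
    \sum_(a <- U) pmixed x U (([set b in U] :|: S) :\ a) T.
Proof.
elim: U x S => [|a U IH] x S f.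
  have -> : [set b in [::]] :|: S = S by apply/setP => b; rewrite !inE.
  by rewrite pmixed_nil derivC big_nil.
have [aU aS aT fU faU] := fresh_cons f.
have aUS : a \notin [set b in U] :|: S by rewrite !inE negb_or aU.
rewrite big_cons set_consU setU1K // (@pmixed_out x a U ([set b in U] :|: S)) //.
rewrite pmixed_cons // derivD derivM derivX mul1r [in X in pmixed _ U X T]setUCA.
rewrite IH // IH // addrCA; congr (_ + _).
rewrite mulr_sumr -big_split /= !big_seq; apply: eq_bigr => b bU.
have ba : b != a by apply: contraNneq aU => <-.
have -> : (a |: ([set b in U] :|: S)) :\ b = a |: (([set b in U] :|: S) :\ b).
  apply/setP => c; rewrite !inE; case: (eqVneq c a) => [->|] /=; rewrite ?orbT ?orbF ?andbT //.
  by rewrite eq_sym ba.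
rewrite pmixed_cons //; last by rewrite inE negb_and aUS orbT.
congr (pmixed _ _ _ _ + _).
by apply/setP => c; rewrite !inE; case: (eqVneq c a) => [->|] /=; rewrite ?orbT ?orbF // eq_sym ba.
Qed.

(** Roots in the open upper half plane are excluded directly, those in the lower one by
    conjugation. *)
Lemma pmixed_root_real x g S T : real_point x -> fresh g S T -> admissible ([set b in g] :|: S) T ->
  minors_pos A x S T -> forall l, root (pmixed x g ([set b in g] :|: S) T) l -> l \is Num.real.
Proof.
move=> xR f w xP.
have nz u : 0 < 'Im u -> M (update x g u) ([set b in g] :|: S) T != 0.
  move=> u0.
  (* The indices of [g] enter one at a time, starting from the positive minor on [S];
     [mixed_minor_root] keeps the value nonzero. *)
  suff H U : {subset U <= g} -> uniq U -> M (update x g u) ([set b in U] :|: S) T != 0.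
    by apply: H => //; case/andP: f.
  elim: U => [|a U IH] Ug uU.
    have -> : [set b in [::]] :|: S = S by apply/setP => b; rewrite !inE.
    rewrite update_out ?gt_eqF ?xP // => a; case/andP: f => _ /allP h /h /andP[]//.
  have ag : a \in g by apply: Ug; rewrite mem_head.
  case/andP: uU => aU uU; rewrite set_consU.
  have /andP[aS aT] : (a \notin S) && (a \notin flatten T) by case/andP: f => _ /allP ->.
  apply: mixed_minor_root => //.
  - by rewrite !inE negb_or aU.
  - apply: admissible_sub w; rewrite -set_consU; apply: setSU.
    by apply/subsetP => b; rewrite !inE; exact: Ug.
  - move=> b; rewrite /update; case: ifP => _; first exact: ltW.
    by rewrite (Creal_ImP _ (xR b)).
  - by rewrite /update ag.
  by apply: IH => // b bU; apply: Ug; rewrite inE bU orbT.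
move=> l; rewrite rootE horner_pmixed => rl; apply/Creal_ImP/eqP.
have IR : 'Im l \is Num.real := Creal_Im l.
rewrite eq_le !real_leNgt ?real0 //; apply/andP; split; apply/negP => lt.
  by have := nz l lt; rewrite rl.
have : 0 < 'Im (l^*) by rewrite Im_conj oppr_gt0.
move/nz; rewrite -(inj_eq (inv_inj (@conjCK C))) conjC0 mixed_minor_conjC //.
move/negP; apply; rewrite -(eqP rl); apply/eqP; apply: eq_mixed_minor => b _.
by rewrite /update; case: ifP; rewrite ?conjCK // (CrealP (xR b)).
Qed.

Lemma pmixed_nevanlinna x g S T v : real_point x -> v \in S -> v \notin g -> admissible S T ->
  forall u, 0 < 'Im u ->
  'Im ((pmixed x g (S :\ v) T).[u] * ((pmixed x g S T).[u])^*) <= 0.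
Proof.
move=> xR vS vg w u u0; rewrite !horner_pmixed; set z := update x g u.
have zv : z v = x v by rewrite /z /update (negbTE vg).
have vT : v \notin flatten T by case/and3P: w => _ /allP h _; apply/negP => /h; rewrite vS.
have z0 b : 0 <= 'Im (z b).
  by rewrite /z /update; case: ifP => _; [exact: ltW|rewrite (Creal_ImP _ (xR b))].
have vv : v \notin S :\ v by rewrite !inE eqxx.
have := mixed_minor_Im hermA vv vT (z := z); rewrite setD1K // => /(_ w z0).
rewrite mulrBl -mulrA -normCK raddfB /= [X in _ - X](Creal_ImP _ _) ?subr0; last first.
  by rewrite zv rpredM ?rpredX ?normr_real.
move=> h; rewrite -oppr_ge0 -Im_conj rmorphM /= conjCK mulrC; exact: h.
Qed.

End Barrier.

(** * Effect of one more group on the barrier functions *)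

Section Step.
Variables (C : numClosedFieldType) (N : nat) (A : 'M[C]_N).
Hypothesis hermA : A^T = map_mx Num.conj A.
Implicit Types (x z : 'I_N -> C) (S : {set 'I_N}) (a b : 'I_N).
Implicit Types (g U : seq 'I_N) (T : seq (seq 'I_N)).

Local Notation M := (mixed_minor A).

(** The mixed minor with one more group depends linearly on the two top coefficients of the diagonal
    restriction; this is what makes [nevanlinna_cone] applicable. *)
Lemma mixed_minor_cons x g S T w s : real_point x -> fresh g S T ->
  (forall a, a \in g -> x a = w) -> forall (p := pmixed A x g ([set b in g] :|: S) T),
  (0 < size g)%N ->
  M (update x g s) S (g :: T) = p`_(size g).-1 + (size g)%:R * s * p`_(size g).
Proof.
move=> xR f xw p g0; have := pmixed_coef A x f; rewrite coefXM.
rewrite (gtn_eqF g0) => ->; rewrite /p (pmixed_size A x f).2.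
have -> : (size g)%:R * s * M x S T = \sum_(a <- g) s * M x S T.
  by rewrite big_const_seq count_predT iter_addr_0 -mulrA mulr_natl.
rewrite -big_split /= !big_seq; apply: eq_bigr => a ag.
have gST b : b \in g -> b \notin S /\ b \notin flatten T.
  by case/andP: f => _ /allP h /h /andP[].
have [aS aT] := gST a ag.
rewrite (mixed_minor_shift _ s xR ag (xw a ag) gST) update_affine // xw // sub0r.
by rewrite mulrBl mulNr addrAC addrA.
Qed.

Lemma horner_rootpoly_gt0 (s : seq C) (w : C) :
  (forall l, l \in s -> l < w) -> 0 < (rootpoly s).[w].
Proof.
move=> sw; rewrite /rootpoly horner_prod big_seq prodr_gt0 // => l ls.
by rewrite hornerXsubC subr_gt0 sw.
Qed.

(** In [barrier_ineq], [Y] plus the sum of the roots is [size g] times [w - d], so the bracket is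
    the next mixed minor by [mixed_minor_cons]. The cone lemma reduces the inequality to the
    polynomials [rootpoly s] and [rootpoly (rem l s)]. *)
Lemma nevanlinna_bound (s : seq C) (p : {poly C}) (w Y : C) :
  (0 < size s)%N -> (forall l, l \in s -> l < w) ->
  (forall l, l \in s -> l \is Num.real) -> (size p <= (size s).+1)%N ->
  nevanlinna p (rootpoly s) -> (forall l, l \in s -> w - l <= Y) ->
  (rootpoly s).[w] * (p`_(size s).-1 + (Y + \sum_(l <- s) l) * p`_(size s)) <= p.[w] * Y.
Proof.
move=> s0 sw sR sp np sY.
pose L h := h.[w] * Y - (rootpoly s).[w] * (h`_(size s).-1 + (Y + \sum_(l <- s) l) * h`_(size s)).
(* [L] vanishes at [rootpoly s]; at [rootpoly (rem l s)] it is nonnegative by the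
   bound [w - l <= Y]. *)
rewrite -subr_ge0 -/(L p); have E : (rootpoly s)`_(size s) = 1.
  have := monic_prod_XsubC s (fun=> true) id.
  by rewrite monicE lead_coefE size_prod_XsubC => /eqP.
apply: (@nevanlinna_cone _ (size s) L s p) => //.
- by move=> h k; rewrite /L hornerD !coefD; ring.
- by move=> c h; rewrite /L hornerZ !coefZ; ring.
- rewrite /L E mulr1 -[_`_(size s).-1](_ : - \sum_(l <- s) l = _).
    ring.
  by rewrite /rootpoly coefPn_prod_XsubC //; case: (s) s0.
move=> l ls; have sl := size_rem ls.
rewrite /L (rootpoly_rem ls) hornerM hornerXsubC.
have -> : (rootpoly (rem l s))`_(size s) = 0.
  by rewrite nth_default // size_rootpoly sl prednK.
have -> : (rootpoly (rem l s))`_(size s).-1 = 1.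
  have := monic_prod_XsubC (rem l s) (fun=> true) id.
  by rewrite monicE lead_coefE size_prod_XsubC sl => /eqP.
rewrite mulr0 addr0 mulr1 [_ * _.[w]]mulrC -mulrBr mulr_ge0 //.
  by apply/ltW/horner_rootpoly_gt0 => m /mem_rem; exact: sw.
by rewrite subr_ge0 sY.
Qed.

(** The polynomials [q] and [p] are the diagonal restrictions for [S1] and [S1 :\ v]. After the
    shift the quotient of mixed minors is [K / (c * Y)]; by [nevanlinna_bound] it is at most [p.[w]
    / q.[w]], which is at most [psi] by hypothesis. *)
Lemma barrier_ineq x g S T v w d psi :
  let S1 := [set b in g] :|: S in
  real_point x -> fresh g S T -> admissible S1 T -> (forall a, a \in g -> x a = w) ->
  w \is Num.real -> minors_pos A x S1 T -> v \in S -> (0 < size g)%N -> 0 < psi ->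
  (forall a, a \in S1 -> M x (S1 :\ a) T <= psi * M x S1 T) ->
  (size g)%:R * d <= (size g).-1%:R ^+ 2 / ((size g)%:R * psi) ->
  0 < M (update x g (w - d)) S (g :: T) ->
  M (update x g (w - d)) (S :\ v) (g :: T) <= psi * M (update x g (w - d)) S (g :: T).
Proof.
move=> S1 xR f w1 xw wR xP vS g0 psi0 bar hd pos.
have gST b : b \in g -> b \notin S /\ b \notin flatten T.
  by case/andP: f => _ /allP h /h /andP[].
have vg : v \notin g by apply/negP => /gST[]; rewrite vS.
have f' : fresh g (S :\ v) T.
  case/andP: f => ug h; rewrite /fresh ug; apply/allP => a /gST[aS ->].
  by rewrite andbT !inE negb_and aS orbT.
pose q := pmixed A x g S1 T; pose p := pmixed A x g (S1 :\ v) T.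
have S1v : S1 :\ v = [set b in g] :|: S :\ v.
  by apply/setP => b; rewrite !inE; case: eqVneq => //= ->; rewrite (negbTE vg).
have xgw S2 : M (update x g w) S2 T = M x S2 T.
  by apply: eq_mixed_minor => b _; rewrite /update; case: ifP => // /xw.
pose c := M x S T; have c0 : 0 < c by apply: xP; exact: subsetUr.
have [sq qc] := pmixed_size A x f; rewrite -/S1 -/q -/c in sq qc.
have sqE : size q = (size g).+1.
  apply/eqP; rewrite eqn_leq sq ltnNge; apply/negP => sg.
  by move: qc c0; rewrite nth_default // => <-; rewrite ltxx.
have [s qs] := closed_field_poly_normal q.
have lq : lead_coef q = c by rewrite lead_coefE sqE.
rewrite lq -/(rootpoly s) in qs.
have ss : size s = size g.
  by have := sqE; rewrite qs size_scale ?gt_eqF // size_rootpoly => -[].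
have rE l : l \in s -> root q l.
  by move=> ls; rewrite qs rootZ ?gt_eqF // root_prod_XsubC.
have sR l : l \in s -> l \is Num.real.
  move=> /rE; apply: (pmixed_root_real hermA xR f w1).
  by apply: minors_posS xP; exact: subsetUr.
have sw l : l \in s -> l < w.
  move=> ls; rewrite (real_ltNge (sR l ls) wR); apply/negP => wl.
  have lP : minors_pos A (update x g l) S1 T.
    by apply: minors_pos_update => // a ag; [rewrite xw|case: (gST a ag)].
  have := lP S1 (subxx _); rewrite -horner_pmixed.
  by have := rE l ls; rewrite rootE => /eqP ->; rewrite ltxx.
have qw : q.[w] = M x S1 T by rewrite horner_pmixed xgw.
have pw : p.[w] = M x (S1 :\ v) T by rewrite horner_pmixed xgw.
have qw0 : 0 < q.[w] by rewrite qw xP.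
have rw0 := horner_rootpoly_gt0 sw.
have vS1 : v \in S1 by rewrite !inE vS orbT.
have np : nevanlinna p (rootpoly s).
  move=> u u0; have := pmixed_nevanlinna hermA xR vS1 vg w1 u0; rewrite -/p -/q qs hornerZ.
  rewrite (rmorphM Num.conj) /= (CrealP (gtr0_real c0)) mulrCA ImMl ?gtr0_real //.
  by rewrite pmulr_rle0.
pose Y := (size g)%:R * (w - d) - \sum_(l <- s) l.
have YE : Y = \sum_(l <- s) (w - l) - (size g)%:R * d.
  rewrite /Y big_split /= sumrN big_const_seq count_predT ss iter_addr_0 -mulr_natl; ring.
(* The left side is the logarithmic derivative of [q] at [w], that is the sum over [g] of the
   barrier functions, each at most [psi]. *)
have harm : \sum_(l <- s) (w - l)^-1 <= (size g)%:R * psi.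
  have ws : w \notin s by apply/negP => /sw; rewrite ltxx.
  have dE : q^`().[w] = q.[w] * \sum_(l <- s) (w - l)^-1.
    by rewrite qs derivZ !hornerZ deriv_rootpoly // mulrA.
  rewrite -(ler_pM2l qw0) -dE /q /S1 (deriv_pmixed A x f) horner_sum -/S1.
  have -> : q.[w] * ((size g)%:R * psi) = \sum_(a <- g) psi * M x S1 T.
    by rewrite big_const_seq count_predT iter_addr_0 qw -mulr_natl; ring.
  rewrite !big_seq; apply: ler_sum => a ag; rewrite horner_pmixed xgw bar //.
  by rewrite !inE ag.
(* It suffices that the gaps [w - m] of the other roots sum to at least [size g] times [d]. By
   [am_hm] and [harm] they sum to at least the right side of [hd]. *)
have sY l : l \in s -> w - l <= Y.
  move=> ls; rewrite YE (perm_big _ (perm_to_rem ls)) big_cons /= -addrA lerDl subr_ge0.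
  apply: le_trans hd _.
  have := @am_hm C [seq w - m | m <- rem l s] ((size g)%:R * psi).
  rewrite size_map size_rem // ss !big_map; apply.
  - by rewrite mulr_gt0 ?ltr0n.
  - by move=> y /mapP[m /mem_rem ms ->]; rewrite subr_gt0 sw.
  apply: le_trans harm; rewrite [leRHS](perm_big _ (perm_to_rem ls)) big_cons /=.
  by rewrite lerDr invr_ge0 subr_ge0 ltW ?sw.
have sp : (size p <= (size s).+1)%N.
  by rewrite ss /p S1v; case: (pmixed_size A x f').
have s0 : (0 < size s)%N by rewrite ss.
have := nevanlinna_bound s0 sw sR sp np sY; rewrite {1}/Y subrK ss.
have := mixed_minor_cons (w - d) xR f' xw g0; rewrite -S1v -/p => <-.
set K := M _ (S :\ v) _ => h.
have cY : M (update x g (w - d)) S (g :: T) = c * Y.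
  rewrite (mixed_minor_cons _ xR f xw g0) -/S1 -/q qc qs coefZ.
  rewrite /rootpoly -ss coefPn_prod_XsubC ?ss //; last by rewrite ?ss -lt0n.
  by rewrite /Y; ring.
rewrite cY -(ler_pM2l qw0).
have -> : q.[w] * (psi * (c * Y)) = psi * q.[w] * (c * Y) by ring.
rewrite cY in pos; apply: (@le_trans _ _ (p.[w] * (c * Y))); last first.
  by rewrite ler_wpM2r ?(ltW pos) // pw qw bar.
have -> : q.[w] * K = c * ((rootpoly s).[w] * K) by rewrite qs hornerZ mulrA.
by rewrite [leRHS]mulrCA ler_pM2l.
Qed.

End Step.

(** * Choosing one index in each group *)

Section Transversal.
Variables (C : numClosedFieldType) (N : nat) (A : 'M[C]_N).
Hypothesis hermA : A^T = map_mx Num.conj A.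
Implicit Types (x z : 'I_N -> C) (S : {set 'I_N}) (a b : 'I_N).
Implicit Types (g U : seq 'I_N) (T : seq (seq 'I_N)).

Local Notation M := (mixed_minor A).

Lemma admissible_drop S T k : admissible S T -> admissible S (drop k T).
Proof.
elim: T k => [|g T IH] [|k] //= w; apply: IH.
case/and3P: w => /=; rewrite cat_uniq all_cat => /and3P[_ _ uT] /andP[_ TS] /andP[_ T0].
exact/and3P.
Qed.

Lemma mem_flatten_drop (b : 'I_N) T k : b \in flatten (drop k T) -> b \in flatten T.
Proof.
by rewrite -{2}(cat_take_drop k T) flatten_cat mem_cat => ->; rewrite orbT.
Qed.

(** Each summand is [M x (a |: S') T - d * M x S' T]. By [ratio_mono] the barrier bound at [S1]
    passes down to [S'], so the subtracted term is at most [d * psi < 1] times the first. *)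
Lemma barrier_pos x g S T w d psi :
  let S1 := [set b in g] :|: S in
  real_point x -> fresh g S T -> admissible S1 T -> (forall a, a \in g -> x a = w) ->
  minors_pos A x S1 T -> g != [::] -> 0 <= d -> d * psi < 1 ->
  (forall a, a \in S1 -> M x (S1 :\ a) T <= psi * M x S1 T) ->
  minors_pos A (update x g (w - d)) S (g :: T).
Proof.
move=> S1 xR f w1 xw xP g0 d0 dpsi bar S' sS /=.
have gST b : b \in g -> b \notin S /\ b \notin flatten T.
  by case/andP: f => _ /allP h /h /andP[].
have gST' b : b \in g -> b \notin S' /\ b \notin flatten T.
  by move=> /gST[bS bT]; split=> //; apply: contra bS; exact: (subsetP sS).
have gt a : a \in g -> 0 < M (update x g (w - d)) (a |: S') T.
  move=> ag; rewrite (mixed_minor_shift _ _ xR ag (xw a ag) gST').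
  rewrite addrAC subrr add0r mulNr subr_gt0.
  have [aS aT] := gST a ag.
  have aS1 : a \in S1 by rewrite !inE ag.
  have aS1a : a \notin S1 :\ a by rewrite !inE eqxx.
  have sS1 : S' \subset S1 :\ a.
    rewrite subsetD1 (gST' a ag).1 andbT; apply: subset_trans sS _; exact: subsetUr.
  have asS1 : a |: S' \subset S1.
    by rewrite subUset sub1set aS1 (subset_trans sS1) // subD1set.
  have := @ratio_mono _ _ A hermA x (S1 :\ a) S' T a xR aS1a aT.
  rewrite setD1K // => /(_ w1 (minors_posS (subD1set _ _) xP) sS1) h.
  have P1 := xP _ (subxx _); have P2 := xP _ asS1.
  have {}h : M x S' T <= psi * M x (a |: S') T.
    rewrite -(ler_pM2l P1); apply: le_trans h _.
    have -> : M x S1 T * (psi * M x (a |: S') T) = M x (a |: S') T * (psi * M x S1 T) by ring.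
    by rewrite ler_pM2l // bar.
  apply: le_lt_trans (ler_wpM2l d0 h) _.
  by rewrite mulrA gtr_pMl.
have [a ag] : exists a, a \in g by case: g g0 {f S1 xw w1 xP bar gST gST' gt} => // b g' _; exists b; rewrite mem_head.
rewrite (perm_big _ (perm_to_rem ag)) big_cons ltr_wpDr ?gt //.
by rewrite big_seq sumr_ge0 // => b /mem_rem bg; rewrite ltW ?gt.
Qed.

(* The last clause bounds the barrier functions, the logarithmic derivatives of
   [M] in the variables not yet grouped; [d] is the shift of the grouped ones. *)
Definition barrier_inv w d psi x S T :=
  [/\ real_point x /\ admissible S T, forall a, a \in S -> x a = w,
      forall a, a \in flatten T -> x a = w - d,
      forall k, minors_pos A x S (drop k T) &
      forall a, a \in S -> M x (S :\ a) T <= psi * M x S T].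

Section Iterate.
Variables (r : nat) (w d psi : C).
Hypotheses (r_gt0 : (0 < r)%N) (wR : w \is Num.real) (d0 : 0 <= d) (psi0 : 0 < psi).
Hypotheses (dpsi : d * psi < 1) (hd : r%:R * d <= r.-1%:R ^+ 2 / (r%:R * psi)).

Lemma barrier_step x S T g : barrier_inv w d psi x S T ->
  uniq g -> {subset g <= S} -> size g = r ->
  barrier_inv w d psi (update x g (w - d)) (S :\: [set b in g]) (g :: T).
Proof.
case=> -[xR wS] xw xT xP bar ug gS gr; set S2 := S :\: _.
have S1 : [set b in g] :|: S2 = S.
  apply/setP => b; rewrite !inE; case: (boolP (b \in g)) => // bg /=.
  by rewrite gS.
have gT a : a \in g -> a \notin flatten T.
  by move=> /gS aS; case/and3P: wS => _ /allP h _; apply/negP => /h; rewrite aS.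
have f : fresh g S2 T.
  by rewrite /fresh ug; apply/allP => a ag; rewrite gT // !inE ag.
have g0 : g != [::] by apply: contraTneq r_gt0 => g0; rewrite -gr g0.
have xgw a : a \in g -> x a = w by move=> ag; rewrite xw // gS.
have dR : d \is Num.real by rewrite ger0_real.
have P0 := xP 0%N; rewrite drop0 in P0.
have P2 : minors_pos A (update x g (w - d)) S2 (g :: T).
  by apply: (@barrier_pos x g S2 T w d psi); rewrite ?S1.
split.
- split; first by apply: real_point_update; rewrite ?rpredB.
  case/and3P: wS => uT /allP TS T0; apply/and3P; split=> /=; last by rewrite g0.
    rewrite cat_uniq ug uT andbT /=; apply/hasPn => b bT; apply/negP => /gS.
    by apply/negP/TS.
  apply/allP => b; rewrite mem_cat !inE => /orP[->//|/TS]; by rewrite negb_and => ->; rewrite orbT.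
- by move=> a; rewrite !inE /update => /andP[/negbTE -> /xw].
- by move=> a; rewrite /= mem_cat /update; case: ifP => //= _ /xT.
- case=> [|k]; first by rewrite drop0.
  move=> S' sS; rewrite /= update_out; first by apply: xP; apply: subset_trans sS _; exact: subsetDl.
  move=> a ag; split; last by apply: contra (gT a ag); exact: mem_flatten_drop.
  by apply/negP => /(subsetP sS); rewrite !inE ag.
move=> v vS; apply: (barrier_ineq hermA (psi := psi) xR f) => //; rewrite ?S1 ?gr //.
by apply: P2.
Qed.

Lemma barrier_iter Gs x S T : barrier_inv w d psi x S T ->
  uniq (flatten Gs) -> {subset flatten Gs <= S} -> all (fun g => size g == r) Gs ->
  exists x' S', barrier_inv w d psi x' S' (catrev Gs T).
Proof.
elim: Gs x S T => [|g Gs IH] x S T inv; first by exists x, S.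
rewrite /= cat_uniq => /and3P[ug ugG uG] sG /andP[/eqP gr Gr].
have gS : {subset g <= S} by move=> a ag; apply: sG; rewrite mem_cat ag.
apply: IH (barrier_step inv ug gS gr) uG _ Gr => a aG.
rewrite !inE sG ?mem_cat ?aG ?orbT // andbT.
by apply: contra ugG => ag; apply/hasP; exists a.
Qed.

End Iterate.

(** The inequality [rayleigh], summed over the indices of the head group. *)
Lemma head_deletion x S T g a : real_point x -> a \notin S -> admissible (a |: S) (g :: T) ->
  M x (a |: S) (g :: T) * M x S T <= M x (a |: S) T * M x S (g :: T).
Proof.
move=> xR aS w; rewrite /= mulr_suml mulr_sumr !big_seq; apply: ler_sum => b bg.
have [baS bT _ w'] := admissible_cons w bg.
have aT : a \notin flatten T.
  case/and3P: w => _ /allP h _; apply/negP => aT; have := h a.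
  by rewrite /= mem_cat aT orbT !inE eqxx => /(_ isT).
move: baS; rewrite !inE negb_or => /andP[ba bS].
rewrite setUCA; apply: rayleigh => //; first by rewrite eq_sym.
by rewrite setUCA.
Qed.

(** A positive sum over the head group has a positive summand, at some [a]. Its positivity passes to
    all suffixes of [T] by [head_deletion], and to all subsets by [ratio_mono], so the choice can
    continue from [a |: S]. *)
Lemma transversal_choice x S T : real_point x -> admissible S T -> (forall k, minors_pos A x S (drop k T)) ->
  exists S', [/\ S \subset S', forall g, g \in T -> exists2 a, a \in g & a \in S',
    forall a, a \in S' -> (a \in S) || (a \in flatten T) & minors_pos A x S' [::]].
Proof.
move=> xR; elim: T S => [|g T IH] S w xP.
  by exists S; split=> // [a ->//|]; have := xP 0%N.
have [a ag aP] : exists2 a, a \in g & 0 < M x (a |: S) T.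
  apply/hasP; apply: contraT => /hasPn h.
  have := xP 0%N S (subxx _); rewrite drop0 /= => /lt_geF/negP[].
  rewrite big_seq sumr_le0 // => a /h.
  by rewrite -real_leNgt ?real0 ?mixed_minor_real.
have [aS aT wT waT] := admissible_cons w ag.
have aPk k : 0 < M x (a |: S) (drop k T).
  elim: k => [|k IHk]; first by rewrite drop0.
  have [sk|sk] := leqP (size T) k; first by move: IHk; rewrite !drop_oversize ?(leq_trans sk).
  have := xP k.+2 S (subxx _); have := xP k.+1 S (subxx _) => /=.
  have wk := admissible_drop k waT.
  move: IHk; rewrite (drop_nth [::] sk) in wk * => hk P1 P2.
  have := head_deletion xR aS wk.
  move=> /(lt_le_trans (mulr_gt0 hk P2)); by rewrite pmulr_lgt0.
have [|S' [SS' S'T S'sub S'P]] := IH _ waT.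
  move=> k S2 sS2; have [aS2|aS2] := boolP (a \in S2); last first.
    apply: (xP k.+1); apply/subsetP => b bS2.
    have := subsetP sS2 b bS2; rewrite !inE => /predU1P[ba|//].
    by rewrite -ba bS2 in aS2.
  have sS3 : S2 :\ a \subset S by rewrite subDset.
  have aTk : a \notin flatten (drop k T) by apply: contra aT; exact: mem_flatten_drop.
  have := ratio_mono hermA xR aS aTk (admissible_drop k waT) (xP k.+1) sS3.
  rewrite setD1K // => /(lt_le_trans (mulr_gt0 (aPk k) (xP k.+1 _ sS3))).
  by rewrite pmulr_lgt0 // (xP k.+1).
have aS' : a \in S' by apply: (subsetP SS'); rewrite setU11.
exists S'; split=> //; first by apply: subset_trans SS'; exact: subsetUr.
  by move=> h; rewrite inE => /predU1P[->|/S'T//]; exists a.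
move=> b /S'sub; rewrite !inE /= mem_cat -orbA => /or3P[/eqP->|->|->//]; rewrite ?ag ?orbT //.
Qed.

End Transversal.

(** * Quadratic forms and minors *)

Section Forms.
Variables (C : numClosedFieldType) (N : nat) (A : 'M[C]_N).
Hypothesis hermA : A^T = map_mx Num.conj A.
Implicit Types (u v w y : 'I_N -> C) (S : {set 'I_N}) (a b : 'I_N).

Definition dotv u v := \sum_a (u a)^* * v a.
Definition mxapp v a := \sum_b A a b * v b.

Lemma qformE u v : qform A u v = dotv u (mxapp v).
Proof.
apply: eq_bigr => a _; rewrite mulr_sumr; apply: eq_bigr => b _; by rewrite mulrA.
Qed.

Lemma dotv_conj u v : (dotv u v)^* = dotv v u.
Proof.
rewrite rmorph_sum; apply: eq_bigr => a _.
by rewrite rmorphM /= conjCK mulrC.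
Qed.

Lemma dotv_subr u v w k : dotv u (fun a => v a - k * w a) = dotv u v - k * dotv u w.
Proof.
rewrite mulr_sumr -sumrB; apply: eq_bigr => a _; ring.
Qed.

Lemma dotv_subl u v w k : dotv (fun a => v a - k * w a) u = dotv v u - k^* * dotv w u.
Proof. by rewrite -dotv_conj dotv_subr rmorphB rmorphM /= !dotv_conj. Qed.

Lemma mxapp_sub v w k a : mxapp (fun a => v a - k * w a) a = mxapp v a - k * mxapp w a.
Proof. rewrite mulr_sumr -sumrB; apply: eq_bigr => b _; ring. Qed.

Lemma dotv_mxapp u v : dotv (mxapp u) v = dotv u (mxapp v).
Proof. by rewrite -qformE -[RHS]conjCK qform_conj // qformE dotv_conj. Qed.

Lemma dotv_gt0 u a : u a != 0 -> 0 < dotv u u.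
Proof.
move=> ua; rewrite /dotv (bigD1 a) //= ltr_pwDl //.
  by rewrite mulrC -normCK exprn_gt0 // normr_gt0.
by apply: sumr_ge0 => b _; rewrite mulrC -normCK exprn_ge0.
Qed.

Lemma eq_dotvr u v v' : v =1 v' -> dotv u v = dotv u v'.
Proof. by move=> vv; apply: eq_bigr => a _; rewrite vv. Qed.

(** Cramer's rule: [y] is column [a] of the inverse of [minor_mx A z S]. *)
Lemma pminor_solve z S a : a \in S -> pminor A z S != 0 ->
  exists y, [/\ y a = pminor A z (S :\ a) / pminor A z S, forall b, b \notin S -> y b = 0 &
    forall c, c \in S -> z c * y c - mxapp y c = (c == a)%:R].
Proof.
move=> aS D0; pose X := minor_mx A z S.
pose y b := cofactor X a b / \det X.
have Xy c : \sum_b X c b * y b = (c == a)%:R.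
  have := mul_mx_adj X => /matrixP /(_ c a); rewrite !mxE => E.
  have -> : \sum_b X c b * y b = (\det X *+ (c == a)) / \det X.
    by rewrite -E mulr_suml; apply: eq_bigr => b _; rewrite !mxE mulrA.
  by rewrite -[\det X *+ _]mulr_natr mulrAC divff // mul1r.
exists y; split.
- congr (_ / _); rewrite /pminor (expand_det_row _ a) (bigD1 a) //= big1 => [|b ba].
    rewrite !mxE !inE eqxx /= mul1r addr0; congr (_ * \det _).
    apply/matrixP => b c; rewrite !mxE !inE [lift a b == a]eq_sym.
    by rewrite (negbTE (neq_lift a b)).
  by rewrite !mxE !inE eqxx /= eq_sym (negbTE ba) mul0r.
- move=> b bS; have := Xy b; rewrite (bigD1 b) //= big1 => [|c cb].
    rewrite mxE (negbTE bS) eqxx mul1r addr0 => ->.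
    by case: eqP bS => // ->; rewrite aS.
  by rewrite mxE (negbTE bS) eq_sym (negbTE cb) mul0r.
move=> c cS; rewrite -(Xy c) (eq_bigr (fun b => z c *+ (c == b) * y b - A c b * y b)).
  rewrite sumrB; congr (_ - _); rewrite (bigD1 c) //= big1 => [|b bc]; first by rewrite eqxx addr0.
  by rewrite eq_sym (negbTE bc) mul0r.
by move=> b _; rewrite mxE cS mulrBl.
Qed.

Definition shift_form (s : C) u v := s * dotv u v - qform A u v.

Lemma shift_form_solve (s : C) u y a S : (forall c, c \notin S -> u c = 0) -> a \in S ->
  (forall c, c \in S -> s * y c - mxapp y c = (c == a)%:R) ->
  shift_form s u y = (u a)^*.
Proof.
move=> u0 aS yE; rewrite /shift_form qformE mulr_sumr -sumrB.
have E c : s * ((u c)^* * y c) - (u c)^* * mxapp y c = (u c)^* * (c == a)%:R.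
  have [cS|cS] := boolP (c \in S); last by rewrite u0 // conjC0; ring.
  by rewrite -yE //; ring.
rewrite (bigD1 a) //= E eqxx mulr1 big1 ?addr0 // => c ca.
by rewrite E (negbTE ca) mulr0.
Qed.

Section Contraction.
Hypothesis contrA : forall v, qform A v v <= dotv v v.
Hypothesis psdA : forall v, 0 <= qform A v v.

Lemma shift_form_gt0 t u a : 1 < t -> u a != 0 -> 0 < shift_form t u u.
Proof.
move=> t1 ua; rewrite subr_gt0; apply: le_lt_trans (contrA u) _.
by rewrite ltr_pMl // (dotv_gt0 ua).
Qed.

(** One half of Sylvester's criterion for the positive definite form of [t - A]: the quotient [y a]
    of consecutive minors is a value of this form, hence positive. *)
Lemma pminor_shift_gt0 t S : 1 < t -> 0 < pminor A (fun=> t) S.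
Proof.
move=> t1; move En: #|S| => n; elim: n S En => [|n IH] S En.
  move/eqP: En; rewrite cards_eq0 => /eqP ->.
  rewrite /pminor (_ : minor_mx _ _ _ = 1%:M) ?det1 //.
  by apply/matrixP => a b; rewrite !mxE inE.
have /card_gt0P[a aS] : (0 < #|S|)%N by rewrite En.
have D0 : pminor A (fun=> t) S != 0.
  apply/eqP => /pminor_ker[v [c vc] [v0 vE]].
  have := shift_form_gt0 t1 vc; rewrite /shift_form qformE mulr_sumr -sumrB big1 ?ltxx // => b _.
  have [bS|bS] := boolP (b \in S); last by rewrite v0 // conjC0; ring.
  have -> : mxapp v b = t * v b by rewrite vE.
  ring.
have [y [ya y0 yE]] := pminor_solve aS D0.
have yn0 : exists b, y b != 0.
  apply/existsP; apply: contraT; rewrite negb_exists => /forallP h.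
  have := yE a aS; rewrite eqxx (eqP (negPn (h a))) mulr0 sub0r /mxapp big1 => [|b _].
    by move/eqP; rewrite oppr0 eq_sym oner_eq0.
  by rewrite (eqP (negPn (h b))) mulr0.
case: yn0 => b /(shift_form_gt0 t1); rewrite (shift_form_solve y0 aS yE) => h.
have {h} : 0 < y a by rewrite -[y a]conjCK (CrealP (gtr0_real h)).
rewrite ya.
have D1 : 0 < pminor A (fun=> t) (S :\ a).
  by apply: IH; apply/eqP; rewrite -eqSS -En (cardsD1 a S) aS.
by rewrite pmulr_rgt0 // invr_gt0.
Qed.

(* [t^-1 + A / (t (t - 1)) - (t - A)^-1] is [A (1 - A) (t - A)^-1 / (t (t - 1))],
   which is positive semidefinite. *)
Lemma pminor_ratio_le t a : 1 < t ->
  pminor A (fun=> t) (setT :\ a) <=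
    (t^-1 + A a a / (t * (t - 1))) * pminor A (fun=> t) setT.
Proof.
move=> t1; have D0 := pminor_shift_gt0 setT t1; rewrite -ler_pdivrMr //.
have t0 : 0 < t := lt_trans ltr01 t1.
have t10 : 0 < t - 1 by rewrite subr_gt0.
have [y [<- _ yE]] := pminor_solve (in_setT a) (lt0r_neq0 D0).
pose p := mxapp y; pose e c : C := (c == a)%:R.
have eE c : e c = t * y c - 1 * p c by rewrite mul1r /e -yE ?inE.
have dote v : dotv e v = v a.
  rewrite /dotv (bigD1 a) //= /e eqxx conjC1 mul1r big1 ?addr0 // => c /negbTE ->.
  by rewrite conjC0 mul0r.
have Ae : mxapp e a = A a a.
  rewrite /mxapp (bigD1 a) //= /e eqxx mulr1 big1 ?addr0 // => c /negbTE ->.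
  by rewrite mulr0.
have tR : t^* = t by apply/CrealP; rewrite gtr0_real.
have dE v : dotv e v = t * dotv y v - dotv p v.
  have -> : dotv e v = dotv (fun c => (fun=> 0) c - (-1) * (t * y c - 1 * p c)) v.
    by apply: eq_bigr => c _; rewrite eE sub0r mulN1r opprK.
  rewrite dotv_subl rmorphN /= conjC1 mulN1r opprK.
  have -> : dotv (fun=> 0) v = 0 by rewrite /dotv big1 // => c _; rewrite conjC0 mul0r.
  rewrite add0r; have -> : dotv (fun c => t * y c - 1 * p c) v = dotv (fun c => t * y c) v - dotv p v.
    by rewrite dotv_subl conjC1 mul1r.
  by congr (_ - _); rewrite /dotv mulr_sumr; apply: eq_bigr => c _; rewrite rmorphM /= tR mulrA.
have appe c : mxapp e c = t * p c - mxapp p c.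
  have -> : mxapp e c = mxapp (fun c => t * y c - 1 * p c) c.
    by apply: eq_bigr => b _; rewrite eE.
  rewrite mxapp_sub mul1r; congr (_ - _); rewrite mulr_sumr.
  by apply: eq_bigr => b _; rewrite mulrCA.
(* All quantities are written in the moments of [A] at [y], of orders 1, 2 and 3. Below, [q1] is the
   contraction property at [p], and [q2] is positivity at [y - p]. *)
pose P1 := dotv y p; pose P2 := dotv p p; pose P3 := dotv p (mxapp p).
have yAp : dotv y (mxapp p) = P2 by rewrite -dotv_mxapp.
have pa : p a = t * P1 - P2 by rewrite -dote dE.
have ya : t * y a = 1 + p a by have := yE a (in_setT a); rewrite eqxx => /(canRL (subrK _)).
have Aaa : A a a = t * (t * P1 - P2) - (t * P2 - P3).
  by rewrite -Ae appe -!dote dE -/P1 dE yAp.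
have q1 : 0 <= P2 - P3 by rewrite subr_ge0 -/(dotv p _) /P3 -qformE.
have q2 : 0 <= P1 - P2 - (P2 - P3).
  have := psdA (fun c => y c - 1 * p c); rewrite qformE.
  rewrite (@eq_dotvr _ _ (fun c => p c - 1 * mxapp p c)) => [|c]; last by rewrite mxapp_sub.
  by rewrite dotv_subr !dotv_subl conjC1 !mul1r yAp.
rewrite -subr_ge0.
have -> : t^-1 + A a a / (t * (t - 1)) - y a =
   ((t - 1) * (P2 - P3) + t * (P1 - P2 - (P2 - P3))) / (t * (t - 1)).
  have -> : y a = (1 + p a) / t by rewrite -ya mulrAC divff ?mul1r ?gt_eqF.
  by rewrite Aaa pa; field; rewrite !gt_eqF.
by rewrite divr_ge0 ?addr_ge0 ?mulr_ge0 // ltW // mulr_gt0.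
Qed.

End Contraction.

(** The other half of Sylvester's criterion, by completing the square: [v] is [k * y] plus a vector
    [u] vanishing at [a], and the form at [v] is the form at [u] plus [|v a| ^+ 2 / y a]. *)
Lemma qform_le_of_minors (s : C) S v : s \is Num.real ->
  (forall S', S' \subset S -> 0 < pminor A (fun=> s) S') ->
  (forall c, c \notin S -> v c = 0) -> qform A v v <= s * dotv v v.
Proof.
move=> bR; move En: #|S| => n; elim: n S v En => [|n IH] S v En SD v0.
  have vz c : v c = 0.
    apply: v0; move/eqP: En; rewrite cards_eq0 => /eqP ->; by rewrite inE.
  rewrite qformE /dotv !big1 ?mulr0 // => c _; by rewrite vz conjC0 mul0r.
have /card_gt0P[a aS] : (0 < #|S|)%N by rewrite En.
have D0 := SD _ (subxx S); have D1 := SD _ (subD1set S a).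
have [y [ya y0 yE]] := pminor_solve aS (lt0r_neq0 D0).
have ya0 : 0 < y a by rewrite ya divr_gt0.
pose k := v a / y a; pose u c := v c - k * y c.
have ua : u a = 0 by rewrite /u divfK ?subrr // gt_eqF.
have u0 c : c \notin S :\ a -> u c = 0.
  rewrite !inE negb_and negbK => /predU1P[->//|cS].
  by rewrite /u v0 // y0 // mulr0 subr0.
have uS c : c \notin S -> u c = 0 by move=> cS; apply: u0; rewrite inE negb_and cS orbT.
have IHu : qform A u u <= s * dotv u u.
  apply: (IH (S :\ a)) => //; first by apply/eqP; rewrite -eqSS -En (cardsD1 a S) aS.
  by move=> S' sS; apply: SD; apply: subset_trans sS (subD1set _ _).
rewrite -subr_ge0 -/(shift_form s v v).
have Br w w1 w2 l : shift_form s w (fun c => w1 c - l * w2 c) =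
    shift_form s w w1 - l * shift_form s w w2.
  rewrite /shift_form !qformE dotv_subr.
  rewrite (@eq_dotvr w (mxapp (fun c => w1 c - l * w2 c)) (fun c => mxapp w1 c - l * mxapp w2 c)) => [|c]; last exact: mxapp_sub.
  by rewrite dotv_subr; ring.
have Bc w1 w2 : (shift_form s w1 w2)^* = shift_form s w2 w1.
  by rewrite rmorphB rmorphM /= (CrealP bR) dotv_conj qform_conj.
have Bvy : shift_form s v y = (v a)^* by apply: shift_form_solve yE.
have Buy : shift_form s u y = 0 by rewrite (shift_form_solve uS aS yE) ua conjC0.
have Buu : shift_form s u u = shift_form s v v - k * (v a)^*.
  rewrite {2}/u Br Buy mulr0 subr0 -Bc {1}/u Br Bvy rmorphB rmorphM /= Bc.
  rewrite conjCK; congr (_ - _); rewrite /k rmorphM /= fmorphV /= (CrealP (gtr0_real ya0)).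
  ring.
have -> : shift_form s v v = shift_form s u u + `|v a| ^+ 2 / y a.
  by rewrite Buu normCK /k mulrAC subrK.
by rewrite addr_ge0 ?subr_ge0 // divr_ge0 ?exprn_ge0 // ltW.
Qed.

End Forms.

(** * Paving *)

Section Paving.
Variable C : numClosedFieldType.

Definition hermitian_contraction N (A : 'M[C]_N) := [/\ A^T = map_mx Num.conj A,
  forall v, qform A v v <= dotv v v & forall v, 0 <= qform A v v].

Lemma transversal_bound (alpha : C) (r : nat) :
  0 <= alpha -> (0 < r)%N -> alpha < (r.-1%:R / r%:R) ^+ 2 ->
  exists s : C, [/\ s \is Num.real, s < 1 & forall N (A : 'M[C]_N) (T : seq (seq 'I_N)),
    hermitian_contraction A -> (forall a, A a a <= alpha) ->
    uniq (flatten T) -> all (fun g => size g == r) T ->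
    exists2 S : {set 'I_N}, (forall g, g \in T -> exists2 a, a \in g & a \in S) &
      forall v, (forall c, c \notin S -> v c = 0) -> qform A v v <= s * dotv v v].
Proof.
move=> al0 r0; set k : C := (_ / _) ^+ 2 => alk.
have rC : 0 < r%:R :> C by rewrite ltr0n.
have k1 : k < 1.
  rewrite expr_lt1 ?divr_ge0 ?ler0n //.
  by rewrite ltr_pdivrMr // mul1r ltr_nat prednK.
have k0 : 0 < k := le_lt_trans al0 alk.
have ak : 0 < 1 - k by rewrite subr_gt0.
(* [t - k / psi < 1] amounts to [t * (1 - k) < 1 - alpha]; as [alpha < k], some
   [t > 1] satisfies it. *)
pose t := (1 + (1 - alpha) / (1 - k)) / 2%:R.
have q1 : 1 < (1 - alpha) / (1 - k) by rewrite ltr_pdivlMr // mul1r ltrD2l ltrN2.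
have t1 : 1 < t by rewrite /t ltr_pdivlMr ?ltr0n // mul1r [2%:R](natrD _ 1 1) ltrD2l.
have tk : t * (1 - k) < 1 - alpha.
  rewrite -ltr_pdivlMr // /t ltr_pdivrMr ?ltr0n // mulr_natr mulr2n ltrD2r //.
have t0 : 0 < t := lt_trans ltr01 t1.
have t10 : 0 < t - 1 by rewrite subr_gt0.
(* The bound of [pminor_ratio_le] on the initial barrier functions. *)
pose psi := t^-1 + alpha / (t * (t - 1)).
have psi0 : 0 < psi by rewrite ltr_pwDl ?invr_gt0 // divr_ge0 // ltW // mulr_gt0.
(* The largest shift that [barrier_ineq] permits: [hd] below is an equality. *)
pose d := k / psi.
have d0 : 0 <= d by rewrite divr_ge0 // ltW.
have tR : t \is Num.real by rewrite gtr0_real.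
exists (t - d); split.
- by rewrite rpredB // ger0_real.
- rewrite ltrBlDr -ltrBlDl /d ltr_pdivlMr // (_ : (t - 1) * psi = (t - 1 + alpha) / t).
    rewrite ltr_pdivrMr // -subr_gt0 (_ : _ - _ = 1 - alpha - t * (1 - k)) ?subr_gt0 //.
    ring.
  by rewrite /psi; field; rewrite !gt_eqF.
move=> N A T [hA cA pA] dA uT sT.
have inv0 : barrier_inv A t d psi (fun=> t) setT [::].
  split=> //.
  - by split.
  - by move=> k' S _; apply: pminor_shift_gt0.
  move=> a _ /=; apply: le_trans (pminor_ratio_le hA cA pA a t1) _.
  rewrite ler_pM2r ?pminor_shift_gt0 // lerD2l ler_pM2r ?dA //.
  by rewrite invr_gt0 mulr_gt0.
have dpsi : d * psi < 1 by rewrite /d divfK ?gt_eqF.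
have hd : r%:R * d <= r.-1%:R ^+ 2 / (r%:R * psi).
  rewrite le_eqVlt; apply/orP; left; apply/eqP; rewrite /d /k.
  by field; rewrite !gt_eqF.
have subT : {subset flatten T <= [set: 'I_N]} by move=> a; rewrite inE.
have [x [S [[xR wS] _ xd xP _]]] := barrier_iter hA r0 tR d0 psi0 dpsi hd inv0 uT subT sT.
(* The choice starts from the empty set, so that all chosen indices lie in groups, where [x] equals
   [t - d]. *)
have wS0 : admissible set0 (catrev T [::]) by apply: admissible_sub wS; exact: sub0set.
have [|S' [_ S'T S'sub S'P]] := transversal_choice hA xR wS0.
  by move=> j; apply: minors_posS (xP j); exact: sub0set.
exists S'.
  by move=> g gT; apply: S'T; rewrite -/(rev T) mem_rev.
move=> v v0; apply: (qform_le_of_minors hA) v0; first by rewrite rpredB // ger0_real.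
move=> S2 sS2; have := S'P S2 sS2; rewrite /= (@eq_pminor _ _ A x (fun=> t - d)) //.
by move=> a /(subsetP sS2)/S'sub; rewrite inE /=; exact: xd.
Qed.

Lemma paving (alpha : C) (r : nat) :
  0 <= alpha -> (0 < r)%N -> alpha < (r.-1%:R / r%:R) ^+ 2 ->
  exists s : C, [/\ s \is Num.real, s < 1 & forall n (H : 'M[C]_n),
    hermitian_contraction H -> (forall i, H i i <= alpha) ->
    exists c : 'I_n -> 'I_r, forall j v, (forall i, c i != j -> v i = 0) ->
      qform H v v <= s * dotv v v].
Proof.
move=> al0 r0 alr; have [s [sR s1 H0]] := transversal_bound al0 r0 alr.
exists s; split=> // n H [hH cH pH] dH.
pose I := ('I_r * 'I_n)%type; pose N := #|{: I}|.
(* One copy of [H] for each colour: choosing [(j, i)] in the group of [i] gives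
   [i] the colour [j]. *)
pose A : 'M[C]_N := \matrix_(p, q) if (enum_val p).1 == (enum_val q).1
  then H (enum_val p).2 (enum_val q).2 else 0.
have sumE (F : 'I_N -> C) : \sum_p F p = \sum_j \sum_i F (enum_rank (j, i)).
  rewrite pair_bigA /= (reindex (@enum_rank I)) /=.
    by apply: eq_bigr => -[].
  by apply: onW_bij; exact: enum_rank_bij.
have dotE (v : 'I_N -> C) : dotv v v = \sum_j dotv (fun i => v (enum_rank (j, i))) (fun i => v (enum_rank (j, i))).
  exact: sumE.
have qE (v : 'I_N -> C) : qform A v v =
    \sum_j qform H (fun i => v (enum_rank (j, i))) (fun i => v (enum_rank (j, i))).
  rewrite /qform; apply: etrans (sumE _) _; apply: eq_bigr => j _; apply: eq_bigr => i _.
  apply: etrans (sumE _) _; rewrite (bigD1 j) //= [X in _ + X]big1 ?addr0 => [|j' jj'].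
    by apply: eq_bigr => i' _; rewrite !mxE !enum_rankK /= eqxx.
  apply: big1 => i' _; rewrite !mxE !enum_rankK /= eq_sym (negbTE jj').
  by rewrite mulr0 mul0r.
have cA : hermitian_contraction A.
  split.
  - apply/matrixP => p q; rewrite !mxE eq_sym; case: eqP => _; last by rewrite conjC0.
    by move/matrixP: hH => /(_ (enum_val p).2 (enum_val q).2); rewrite !mxE.
  - by move=> v; rewrite qE dotE; apply: ler_sum.
  - by move=> v; rewrite qE; apply: sumr_ge0.
have dA a : A a a <= alpha by rewrite mxE eqxx.
pose grp i := [seq enum_rank (j, i) : 'I_N | j <- enum 'I_r].
pose T := [seq grp i | i <- enum 'I_n].
have mem_grp i a : (a \in grp i) = ((enum_val a).2 == i).
  apply/mapP/eqP => [[j _ ->]|<-]; first by rewrite enum_rankK.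
  by exists (enum_val a).1; rewrite ?mem_enum // -surjective_pairing enum_valK.
have uT : uniq (flatten T).
  rewrite /T; elim: (enum 'I_n) (enum_uniq 'I_n) => //= i e IH /andP[ie ue].
  rewrite cat_uniq IH // andbT; apply/andP; split.
    by rewrite map_inj_uniq ?enum_uniq // => j j' /enum_rank_inj[].
  apply/hasPn => a /flattenP[g /mapP[i' ie' ->]].
  by rewrite !mem_grp => /eqP ->; apply: contraNneq ie => <-.
have sT : all (fun g => size g == r) T.
  by apply/allP => g /mapP[i _ ->]; rewrite size_map size_enum_ord.
have [S ST SB] := H0 N A T cA dA uT sT.
have cS i : exists j, enum_rank (j, i) \in S.
  have [|a] := ST (grp i); first by rewrite map_f // mem_enum.
  rewrite mem_grp => /eqP <- aS; exists (enum_val a).1.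
  by rewrite -surjective_pairing enum_valK.
exists (fun i => xchoose (cS i)) => j v v0.
(* The vector [v] is placed in copy [j]; it is supported in [S], since an index of colour [j] has
   its copy [j] chosen. *)
pose V (p : 'I_N) := if (enum_val p).1 == j then v (enum_val p).2 else 0.
have VE j' : (fun i => V (enum_rank (j', i))) =1 (fun i => if j' == j then v i else 0).
  by move=> i; rewrite /V enum_rankK.
have := SB V; rewrite qE dotE (bigD1 j) //= [X in _ + X]big1 ?addr0 => [|j' jj'].
  rewrite [X in _ <= _ * X](bigD1 j) //= [X in _ * (_ + X)]big1 ?addr0 => [|j' jj'].
    have -> : qform H (fun i => V (enum_rank (j, i))) (fun i => V (enum_rank (j, i))) = qform H v v.
      by apply: eq_bigr => i _; apply: eq_bigr => i' _; rewrite !VE eqxx.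
    have -> : dotv (fun i => V (enum_rank (j, i))) (fun i => V (enum_rank (j, i))) = dotv v v.
      by apply: eq_bigr => i _; rewrite !VE eqxx.
    apply=> p pS; rewrite /V; case: eqP => // pj; apply: v0.
    apply: contraNneq pS => cj.
    have := xchooseP (cS (enum_val p).2); rewrite cj -pj -surjective_pairing.
    by rewrite enum_valK.
  by apply: big1 => i _; rewrite !VE (negbTE jj') mulr0.
by apply: big1 => i _; apply: big1 => i' _; rewrite !VE (negbTE jj') mulr0.
Qed.

End Paving.

From mathcomp Require Import all_classical all_reals all_analysis.
From mathcomp Require Import complex lra.

Import numFieldNormedType.Exports.

Local Open Scope classical_set_scope.
Local Open Scope ring_scope.
Local Open Scope complex_scope.

(** * Square-summable sequences *)

Section SquareSums.
Variable R : realType.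
Implicit Types (u : nat -> R[i]) (x y z : ell2 R) (c : R[i]).

Lemma sqr_modulus (z : R[i]) : modulus z ^+ 2 = complex.Re z ^+ 2 + complex.Im z ^+ 2.
Proof. by case: z => a b; rewrite /modulus /= sqr_sqrtr // addr_ge0 ?sqr_ge0. Qed.

Definition psum u n : R := \sum_(0 <= k < n) modulus (u k) ^+ 2.

Lemma psumE u n : (psum u n)%:E = (\sum_(0 <= k < n) (modulus (u k) ^+ 2)%:E)%E.
Proof. by rewrite /psum sumEFin. Qed.

Lemma sqsum_series u : sqsum setT u = (\sum_(0 <= k <oo) (modulus (u k) ^+ 2)%:E)%E.
Proof. by rewrite /sqsum -nneseries_esumT // => k; rewrite lee_fin sqr_ge0. Qed.

Lemma psum_cvg_ereal u :
  ((psum u n)%:E @[n --> \oo] --> sqsum setT u)%E.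
Proof.
rewrite sqsum_series; under eq_fun do rewrite psumE.
by apply: is_cvg_nneseries => k _ _; rewrite lee_fin sqr_ge0.
Qed.

Lemma sqsum_le u (b : R) : (forall n, psum u n <= b) -> (sqsum setT u <= b%:E)%E.
Proof.
move=> ub; rewrite sqsum_series; apply: lime_le.
  by apply: is_cvg_nneseries => k _ _; rewrite lee_fin sqr_ge0.
by apply: nearW => n; rewrite -psumE lee_fin.
Qed.

Lemma sqsum_fin u : (sqsum setT u < +oo)%E -> (fine (sqsum setT u))%:E = sqsum setT u.
Proof. by move=> uoo; rewrite fineK // ge0_fin_numE // sqsum_ge0. Qed.

Lemma psum_le u n : (sqsum setT u < +oo)%E -> psum u n <= fine (sqsum setT u).
Proof.
move=> uoo; rewrite -lee_fin sqsum_fin // psumE sqsum_series.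
by apply: nneseries_lim_ge => k _ _; rewrite lee_fin sqr_ge0.
Qed.

Lemma psum_cvg u : (sqsum setT u < +oo)%E -> psum u n @[n --> \oo] --> fine (sqsum setT u).
Proof.
move=> uoo; have := @psum_cvg_ereal u; rewrite -sqsum_fin // => /fine_cvgP[_].
exact.
Qed.

Definition sqnorm x := fine (sqsum setT x).

Lemma ell2_fin x : (sqsum setT x < +oo)%E.
Proof. by have := valP x; rewrite inE. Qed.

Lemma sqnorm_ge0 x : 0 <= sqnorm x.
Proof. by apply: fine_ge0; exact: sqsum_ge0. Qed.

Lemma sqr_ell2_norm x : ell2_norm x ^+ 2 = sqnorm x.
Proof. by rewrite /ell2_norm sqr_sqrtr // sqnorm_ge0. Qed.

Lemma sqnorm_cvg x : psum x n @[n --> \oo] --> sqnorm x.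
Proof. by apply: psum_cvg; exact: ell2_fin. Qed.

Lemma ell2D x y k : ell2_seq (x + y) k = x k + y k. Proof. by []. Qed.
Lemma ell2N x k : ell2_seq (- x) k = - x k. Proof. by []. Qed.
Lemma ell2B x y k : ell2_seq (x - y) k = x k - y k. Proof. by []. Qed.
Lemma ell2Z c x k : ell2_seq (c *: x) k = c * x k. Proof. by []. Qed.

Lemma ell2_sum (I : Type) (r : seq I) (P : pred I) (F : I -> ell2 R) k :
  ell2_seq (\sum_(i <- r | P i) F i) k = \sum_(i <- r | P i) F i k.
Proof. by elim/big_rec2: _ => // i z w _ <-. Qed.

Lemma sqnormD x y : sqnorm (x + y) <= 2 * (sqnorm x + sqnorm y).
Proof.
have := @sqsumD R x y; rewrite -(sqsum_fin (ell2_fin x)) -(sqsum_fin (ell2_fin y)).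
rewrite -EFinD -EFinM -[X in (X <= _)%E](sqsum_fin (ell2_fin (x + y))) lee_fin.
exact.
Qed.

End SquareSums.

(** * The inner product as a limit of partial sums *)

Section Dot.
Variable R : realType.
Implicit Types (x y z : ell2 R) (c : R[i]).

Lemma cvg_real_complex (f : nat -> R) (l : R) : f @ \oo --> l ->
  ((f n)%:C : R[i]^o) @[n --> \oo] --> (l%:C : R[i]^o).
Proof.
move=> fl; apply/cvgrPdist_le => e e0.
have [er eE] : exists r, e = r%:C by apply/complex_realP; rewrite gtr0_real.
rewrite eE in e0 *; move: e0; rewrite ltcR => er0.
move/cvgrPdist_le: fl => /(_ er er0); apply: filterS => n.
by rewrite -rmorphB /= normc_def /= expr0n addr0 sqrtr_sqr lecR.
Qed.

Definition dsum x y n : R[i] := \sum_(0 <= k < n) x k * (y k)^*%C.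

(* By polarization, the partial sums of the inner product are combinations of
   partial sums of squared moduli, whence their convergence. *)
Definition polar x y : R[i] :=
  ((sqnorm (x + y) - sqnorm (x - y)) / 4)%:C +
  ((sqnorm (x + 'i%C *: y) - sqnorm (x - 'i%C *: y)) / 4)%:C * 'i%C.

Lemma dsum_polar x y n : dsum x y n =
  ((psum (ell2_seq (x + y)) n - psum (ell2_seq (x - y)) n) / 4)%:C +
  ((psum (ell2_seq (x + 'i%C *: y)) n - psum (ell2_seq (x - 'i%C *: y)) n) / 4)%:C * 'i%C.
Proof.
rewrite /dsum /psum -!sumrB !mulr_suml !rmorph_sum mulr_suml -big_split.
apply: eq_bigr => k _; rewrite !sqr_modulus !ell2D !ell2N !ell2Z.
case: (x k) => a b; case: (y k) => p q; simpc; rewrite /=; by congr (_ +i* _); field.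
Qed.

Lemma dsum_cvg x y : (dsum x y n : R[i]^o) @[n --> \oo] --> (polar x y : R[i]^o).
Proof.
rewrite (_ : (fun n => _) = (fun n => (((psum (ell2_seq (x + y)) n - psum (ell2_seq (x - y)) n) / 4)%:C : R[i]^o) +
  (((psum (ell2_seq (x + 'i%C *: y)) n - psum (ell2_seq (x - 'i%C *: y)) n) / 4)%:C : R[i]^o) * 'i%C)); last first.
  by apply/funext => n; exact: dsum_polar.
by apply: cvgD; last apply: cvgMr_tmp; apply: cvg_real_complex;
  apply: cvgMr_tmp; apply: cvgB; exact: sqnorm_cvg.
Qed.

Lemma dot_cvg x y : (dsum x y n : R[i]^o) @[n --> \oo] --> (ell2_dot x y : R[i]^o).
Proof.
have -> : ell2_dot x y = polar x y.
  by apply: (@cvg_lim R[i]^o (@norm_hausdorff _ R[i]^o)); exact: dsum_cvg.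
exact: dsum_cvg.
Qed.

Lemma cvgn_unique (f : nat -> R[i]^o) (a b : R[i]^o) : f @ \oo --> a -> f @ \oo --> b -> a = b.
Proof.
exact: (cvg_unique (@norm_hausdorff _ R[i]^o)).
Qed.

Lemma dotDl x y z : ell2_dot (x + y) z = ell2_dot x z + ell2_dot y z.
Proof.
apply: (cvgn_unique (@dot_cvg _ _)).
rewrite (_ : (fun n => _) = (fun n => (dsum x z n : R[i]^o) + (dsum y z n : R[i]^o))).
  by apply: cvgD; exact: dot_cvg.
apply/funext => n; rewrite /dsum -big_split; apply: eq_bigr => k _.
by rewrite ell2D mulrDl.
Qed.

Lemma dotZl c x z : ell2_dot (c *: x) z = c * ell2_dot x z.
Proof.
apply: (cvgn_unique (@dot_cvg _ _)).
rewrite (_ : (fun n => _) = (fun n => (c : R[i]^o) * (dsum x z n : R[i]^o))).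
  by apply: cvgMl_tmp; exact: dot_cvg.
apply/funext => n; rewrite /dsum mulr_sumr; apply: eq_bigr => k _.
by rewrite ell2Z mulrA.
Qed.

Lemma dot_conj x y : (ell2_dot x y)^*%C = ell2_dot y x.
Proof.
apply: (cvgn_unique _ (@dot_cvg _ _)).
rewrite (_ : (fun n => _) = (fun n => ((dsum x y n)^*%C : R[i]^o))).
  apply/cvgrPdist_le => e e0.
  move/cvgrPdist_le: (@dot_cvg x y) => /(_ e e0); apply: filterS => n.
  by rewrite -rmorphB /= normcJ.
apply/funext => n; rewrite /dsum rmorph_sum; apply: eq_bigr => k _.
by rewrite rmorphM /= conjcK mulrC.
Qed.

Lemma dotZr c x z : ell2_dot z (c *: x) = c^*%C * ell2_dot z x.
Proof. by rewrite -dot_conj dotZl rmorphM /= dot_conj. Qed.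

Lemma dot0l z : ell2_dot 0 z = 0.
Proof. by rewrite -(scale0r 0) dotZl mul0r. Qed.

Lemma dot_suml (I : Type) (r : seq I) (P : pred I) (F : I -> ell2 R) z :
  ell2_dot (\sum_(i <- r | P i) F i) z = \sum_(i <- r | P i) ell2_dot (F i) z.
Proof. by elim/big_rec2: _ => [|i u v _ <-]; rewrite ?dot0l ?dotDl. Qed.

Lemma dot_sumr (I : Type) (r : seq I) (P : pred I) (F : I -> ell2 R) z :
  ell2_dot z (\sum_(i <- r | P i) F i) = \sum_(i <- r | P i) ell2_dot z (F i).
Proof.
by rewrite -dot_conj dot_suml rmorph_sum; apply: eq_bigr => i _; rewrite /= dot_conj.
Qed.

Lemma dot_self x : ell2_dot x x = (sqnorm x)%:C.
Proof.
apply: (cvgn_unique (@dot_cvg _ _)).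
rewrite (_ : (fun n => _) = (fun n => ((psum x n)%:C : R[i]^o))).
  by apply: cvg_real_complex; exact: sqnorm_cvg.
apply/funext => n; rewrite /dsum /psum rmorph_sum; apply: eq_bigr => k _.
rewrite sqr_modulus; case: (x k) => a b; simpc; rewrite /=; congr (_ +i* _); ring.
Qed.

End Dot.

(** * Compactness *)

Section Konig.
Variables (F : finType) (P : nat -> (nat -> F) -> Prop).
Hypothesis mono : forall m n c, (m <= n)%N -> P n c -> P m c.
Hypothesis local : forall n c c', (forall i, (i < n)%N -> c i = c' i) -> P n c -> P n c'.
Hypothesis inh : forall n, exists c, P n c.

(** The prefix of length [k] of [c] extends to a solution at every stage [n]. *)
Let ext (k : nat) (c : nat -> F) :=
  forall n, exists c', P n c' /\ forall i, (i < k)%N -> c' i = c i.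

(** If each value [j] failed at some stage [N j], a solution extending the prefix at the largest of
    these finitely many stages would, by [mono], contradict the failure of its own value at [k]. *)
Lemma konig_step k c : ext k c ->
  exists j, ext k.+1 (fun i => if i == k then j else c i).
Proof.
move=> ec; apply: contrapT => /forallNP h.
have {}h j : exists n, forall c', P n c' -> ~ forall i, (i < k.+1)%N -> c' i = if i == k then j else c i.
  have /existsNP[n nP] := h j; exists n => c' Pc' cc'; apply: nP; by exists c'.
have [N NP] := choice h.
have [c' [Pc' cc']] := ec (\max_j N j).
apply: (NP (c' k) c').
  apply: mono Pc'; exact: (leq_bigmax (c' k)).
move=> i; rewrite ltnS leq_eqVlt; case: eqP => [->//|_ /= ik]; exact: cc'.
Qed.

(** Prefixes are extended by repeated choice. The limit takes its value at [i] from stage [i.+1],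
    and later stages never change it. *)
Lemma konig : exists c, forall n, P n c.
Proof.
have [c0 _] := inh 0.
have e0 : ext 0 c0 by move=> n; have [c Pc] := inh n; exists c.
have st (kc : {kc : nat * (nat -> F) | ext kc.1 kc.2}) :
    exists kc' : {kc : nat * (nat -> F) | ext kc.1 kc.2},
      (sval kc').1 = (sval kc).1.+1 /\
      forall i, (i < (sval kc).1)%N -> (sval kc').2 i = (sval kc).2 i.
  case: kc => -[k c] /= ec; have [j ej] := konig_step ec.
  exists (exist (fun kc => ext kc.1 kc.2) (k.+1, fun i => if i == k then j else c i) ej) => /=.
  by split=> // i ik; rewrite ltn_eqF.
have [f fP] := choice st.
pose s := fix s n := if n is m.+1 then f (s m) else
  exist (fun kc => ext kc.1 kc.2) (0%N, c0) e0.
have s1 n : (sval (s n)).1 = n by elim: n => //= n IH; rewrite (fP (s n)).1 IH.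
have sE m n i : (i < m)%N -> (m <= n)%N -> (sval (s n)).2 i = (sval (s m)).2 i.
  move=> im; elim: n => [|n IH]; first by rewrite leqn0 => /eqP m0; rewrite m0 in im.
  rewrite leq_eqVlt => /predU1P[<-//|]; rewrite ltnS => mn.
  by rewrite /= (fP (s n)).2 ?IH // s1 (leq_trans im).
exists (fun i => (sval (s i.+1)).2 i) => n.
have [c' [Pc' cc']] := svalP (s n) n.
apply: local Pc' => i ilt; rewrite cc' ?s1 //; exact: sE.
Qed.

End Konig.

(** * Riesz sequences *)

Section Synthesis.
Variables (R : realType) (phi : nat -> ell2 R) (B : R).
Hypothesis B0 : 0 < B.
Implicit Types (a : nat -> R[i]) (x s : ell2 R).

Definition synth a n : ell2 R := \sum_(0 <= i < n) a i *: phi i.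

Hypothesis bessel : forall x n,
  \sum_(0 <= i < n) modulus (ell2_dot x (phi i)) ^+ 2 <= B * sqnorm x.

(** Duality: synthesis is adjoint to taking inner products with the [phi i], so it inherits the
    Bessel bound. *)
Lemma sqnorm_synth a n : sqnorm (synth a n) <= B * psum a n.
Proof.
set t := synth a n.
have tE : sqnorm t = \sum_(0 <= i < n) complex.Re ((a i)^*%C * ell2_dot t (phi i)).
  have := dot_self t; rewrite {2}/t /synth dot_sumr => /(congr1 (@complex.Re R)) /= <-.
  rewrite raddf_sum; apply: eq_bigr => i _; by rewrite dotZr.
(* AM-GM: [2 B Re (a^* d) <= B ^+ 2 |a| ^+ 2 + |d| ^+ 2] *)
have h : 2 * B * sqnorm t <= B ^+ 2 * psum a n + B * sqnorm t.
  apply: le_trans (lerD (lexx _) (bessel t n)).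
  rewrite {1}tE /psum !mulr_sumr -big_split; apply: ler_sum => i _.
  rewrite /= !sqr_modulus; case: (a i) => p q; case: (ell2_dot _ _) => u v /=.
  rewrite -subr_ge0 (_ : _ - _ = (B * p - u) ^+ 2 + (B * q - v) ^+ 2); last ring.
  by rewrite addr_ge0 ?sqr_ge0.
by rewrite -(ler_pM2l B0); nra.
Qed.

Definition trunc m a n := if (n < m)%N then a n else 0.
Definition tail m a n := if (n < m)%N then 0 else a n.

Lemma modulus0 : modulus (0 : R[i]) = 0.
Proof. by rewrite /modulus ComplexField.Normc.normc0. Qed.

Lemma psum_trunc m n a : (m <= n)%N -> psum (trunc m a) n = psum a m.
Proof.
move=> mn; rewrite /psum (big_cat_nat (leq0n m) mn) //= [X in _ + X]big_nat_cond [X in _ + X]big1 ?addr0.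
  by apply: eq_big_nat => i /andP[_ im]; rewrite /trunc im.
by move=> i /andP[/andP[mi _] _]; rewrite /trunc ltnNge mi modulus0 expr0n.
Qed.

Lemma synth_trunc m n a : (m <= n)%N -> synth (trunc m a) n = synth a m.
Proof.
move=> mn; rewrite /synth (big_cat_nat (leq0n m) mn) //= [X in _ + X]big_nat_cond [X in _ + X]big1 ?addr0.
  by apply: eq_big_nat => i /andP[_ im]; rewrite /trunc im.
by move=> i /andP[/andP[mi _] _]; rewrite /trunc ltnNge mi scale0r.
Qed.

Lemma psum_tail m n a : (m <= n)%N -> psum (tail m a) n = psum a n - psum a m.
Proof.
move=> mn; rewrite /psum !(big_cat_nat (leq0n m) mn) //= addrAC subrr add0r.
rewrite big_nat_cond big1 ?add0r.
  by apply: eq_big_nat => i /andP[mi _]; rewrite /tail ltnNge mi.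
by move=> i /andP[/andP[_ im] _]; rewrite /tail im modulus0 expr0n.
Qed.

Lemma synth_tail m n a : (m <= n)%N -> synth (tail m a) n = synth a n - synth a m.
Proof.
move=> mn; rewrite /synth !(big_cat_nat (leq0n m) mn) //= addrAC subrr add0r.
rewrite big_nat_cond big1 ?add0r.
  by apply: eq_big_nat => i /andP[mi _]; rewrite /tail ltnNge mi.
by move=> i /andP[/andP[_ im] _]; rewrite /tail im scale0r.
Qed.

Lemma coord_le x k : modulus (x k) ^+ 2 <= sqnorm x.
Proof.
apply: le_trans (psum_le k.+1 (ell2_fin x)).
by rewrite /psum big_nat_recr //= lerDr sumr_ge0 // => i _; rewrite sqr_ge0.
Qed.

Section Limit.
Variable a : nat -> R[i].
Hypothesis afin : (sqsum setT a < +oo)%E.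

Lemma synth_diff m n : (m <= n)%N ->
  sqnorm (synth a n - synth a m) <= B * (psum a n - psum a m).
Proof. by move=> mn; rewrite -synth_tail // -psum_tail // sqnorm_synth. Qed.

Lemma cvgn_series_sqr (v : nat -> R) :
  (forall m n, (m <= n)%N -> (\sum_(m <= i < n) v i) ^+ 2 <= B * (psum a n - psum a m)) ->
  cvgn (series v).
Proof.
move=> vB; apply/cauchy_cvgP/cauchy_seriesP => e e0.
have ac : cvgn (series (fun i => modulus (a i) ^+ 2)).
  by apply/cvg_ex; exists (fine (sqsum setT a)); exact: psum_cvg.
move: ac => /cauchy_cvgP/cauchy_seriesP /(_ (e ^+ 2 / B)).
have eB : 0 < e ^+ 2 / B by rewrite divr_gt0 ?exprn_gt0.
move=> /(_ eB); apply: filterS => -[m n] /= h.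
have [mn|/ltnW nm] := leqP m n; last by rewrite big_geq // normr0.
rewrite -(@ltr_pXn2r _ 2) ?nnegrE ?(ltW e0) // -normrX ger0_norm ?sqr_ge0 //.
apply: le_lt_trans (vB m n mn) _.
rewrite mulrC -ltr_pdivlMr //; apply: le_lt_trans h.
rewrite (_ : psum a n - psum a m = \sum_(m <= i < n) modulus (a i) ^+ 2) ?ler_norm //.
by rewrite /psum (big_cat_nat (leq0n m) mn) //= addrAC subrr add0r.
Qed.

(** The limit [s] is taken coordinate by coordinate. The tail estimate passes to the limit on each
    finite set of coordinates, then to the whole norm. *)
Lemma synth_lim : exists s, forall m,
  sqnorm (s - synth a m) <= B * (fine (sqsum setT a) - psum a m).
Proof.
pose v k i := complex.Re (a i * phi i k); pose w k i := complex.Im (a i * phi i k).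
have vS k n : series (v k) n = complex.Re (synth a n k).
  by rewrite /synth ell2_sum raddf_sum.
have wS k n : series (w k) n = complex.Im (synth a n k).
  by rewrite /synth ell2_sum raddf_sum.
have sub_series (u : nat -> R) m n : (m <= n)%N ->
    \sum_(m <= i < n) u i = series u n - series u m.
  by move=> mn; rewrite /series /= (big_cat_nat (leq0n m) mn) //= addrAC subrr add0r.
have cv k : cvgn (series (v k)).
  apply: cvgn_series_sqr => m n mn; apply: le_trans (synth_diff mn).
  apply: le_trans (coord_le _ k); rewrite sub_series // !vS sqr_modulus ell2B !raddfB.
  by rewrite lerDl sqr_ge0.
have cw k : cvgn (series (w k)).
  apply: cvgn_series_sqr => m n mn; apply: le_trans (synth_diff mn).
  apply: le_trans (coord_le _ k); rewrite sub_series // !wS sqr_modulus ell2B !raddfB.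
  by rewrite lerDr sqr_ge0.
pose s k := limn (series (v k)) +i* limn (series (w k)).
have cs m K : psum (synth a n - synth a m : ell2 R) K @[n --> \oo] -->
    \sum_(0 <= k < K) modulus (s k - synth a m k) ^+ 2.
  elim: K => [|K IH].
    rewrite (_ : (fun n => _) = (fun=> 0)); last by apply/funext => n; rewrite /psum big_geq.
    by rewrite big_geq //; exact: cvg_cst.
  rewrite big_nat_recr //= (_ : (fun n => _) = (fun n => psum (synth a n - synth a m : ell2 R) K +
     ((series (v K) n - complex.Re (synth a m K)) ^+ 2 +
      (series (w K) n - complex.Im (synth a m K)) ^+ 2))); last first.
    apply/funext => n; rewrite /psum big_nat_recr //= sqr_modulus vS wS.
    by rewrite -!raddfB.
  apply: cvgD => //; rewrite sqr_modulus /s.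
  case: (synth a m K) => p q /=.
  by apply: cvgD; rewrite expr2; under eq_fun do rewrite expr2;
    apply: cvgM; apply: cvgB; try exact: cvg_cst; [exact: cv..|exact: cw|exact: cw].
have le m K : \sum_(0 <= k < K) modulus (s k - synth a m k) ^+ 2 <=
    B * (fine (sqsum setT a) - psum a m).
  apply: (cvgr_to_le (cs m K)); exists m => // n mn.
  apply: le_trans (psum_le K (ell2_fin _)) _; apply: le_trans (synth_diff mn) _.
  by rewrite ler_pM2l // lerD2r psum_le.
have s_in : s \in @square_summable R.
  rewrite inE; apply: le_lt_trans (sqsum_le (b := B * (fine (sqsum setT a) - psum a 0)) _) (ltry _).
  move=> n; apply: le_trans (le 0%N n); rewrite /psum; apply: ler_sum => k _.
  by rewrite /synth big_geq // subr0.
exists (Ell2 s_in) => m; rewrite -lee_fin sqsum_fin ?ell2_fin //.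
by apply: sqsum_le => n; exact: le.
Qed.

End Limit.

End Synthesis.

(** * Lower bounds on finite sections, and finite colourings *)

Section Riesz.
Variables (R : realType) (phi : nat -> ell2 R) (B : R).
Hypothesis B0 : 0 < B.
Hypothesis bessel : forall x n,
  \sum_(0 <= i < n) modulus (ell2_dot x (phi i)) ^+ 2 <= B * sqnorm x.

Lemma sqnormN (x : ell2 R) : sqnorm (- x) = sqnorm x.
Proof.
rewrite /sqnorm -scaleN1r sqsumZ sqr_modulus /= oppr0 expr0n addr0 sqrrN expr1n.
by rewrite mul1e.
Qed.

Definition lower_bound (eta : R) n (I : set nat) :=
  forall v : nat -> R[i], (forall i, ~ I i -> v i = 0) ->
    eta * psum v n <= sqnorm (synth phi v n).

Lemma riesz_of_lower_bound (eta : R) (I : set nat) : 0 < eta ->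
  (forall n, lower_bound eta n I) -> is_riesz_sequence I phi.
Proof.
(* The factor [1 / 2] comes from [sqnormD], used in place of the triangle
   inequality. *)
move=> eta0 lb; exists (eta / 2), B; split=> //; first by rewrite divr_gt0.
move=> a aI; pose v i := if i \in I then a i else 0.
have v0 i : ~ I i -> v i = 0 by move=> Ii; rewrite /v memNset.
have aE : sqsum I a = sqsum setT v.
  rewrite /sqsum esum_mkcond; apply: eq_esum => i _; rewrite /v.
  by case: ifP => // _; rewrite modulus0 expr0n.
rewrite aE in aI *; set L := fine _.
have [s sP] := synth_lim B0 bessel aI; rewrite -/L in sP.
have sumE N : \sum_(0 <= n < N | n \in I) a n *: phi n = synth phi v N.
  rewrite /synth big_mkcond; apply: eq_bigr => i _; rewrite /v.
  by case: ifP => // _; rewrite scale0r.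
have cP : psum v n @[n --> \oo] --> L by exact: psum_cvg.
have cB : B * (L - psum v n) @[n --> \oo] --> (0 : R).
  rewrite -(mulr0 B) -(subrr L); apply: cvgM; first exact: cvg_cst.
  by apply: cvgB => //; exact: cvg_cst.
exists s; split.
- rewrite /is_sum; under eq_fun do rewrite sumE.
  have cS : Num.sqrt (B * (L - psum v n)) @[n --> \oo] --> (0 : R).
    rewrite -sqrtr0; apply: (cvg_comp _ _ cB); exact: sqrt_continuous.
  apply: (squeeze_cvgr _ (cvg_cst 0) cS); apply: nearW => n.
  rewrite sqrtr_ge0 /= /ell2_norm ler_sqrt //; first exact: sP.
  by apply: le_trans (sqnorm_ge0 _) (sP n).
- rewrite sqr_ell2_norm.
  (* The finite lower bound passes to the limit: [synth phi v n] differs from [s] by a vector of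
     squared norm at most [B * (L - psum v n)]. *)
  have c2 : 2 * (sqnorm s + B * (L - psum v n)) - eta * psum v n @[n --> \oo] -->
      2 * (sqnorm s + 0) - eta * L.
    apply: cvgB; apply: cvgM => //; try exact: cvg_cst.
    by apply: cvgD => //; exact: cvg_cst.
  have : 0 <= 2 * (sqnorm s + 0) - eta * L.
    apply: (cvgr_to_ge c2); apply: nearW => n; rewrite subr_ge0.
    apply: le_trans (lb n v v0) _.
    rewrite -[synth phi v n](subKr s); apply: le_trans (sqnormD _ _) _.
    by rewrite ler_pM2l // lerD2l sqnormN.
  by rewrite addr0; lra.
rewrite sqr_ell2_norm -(subr0 s).
have -> : 0 = synth phi v 0 by rewrite /synth big_geq.
by apply: le_trans (sP 0%N) _; rewrite /psum big_geq // subr0.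
Qed.

(** Truncation at [m] reduces stage [m] to stage [n]. This supplies both the monotonicity and the
    locality required by [konig]. *)
Lemma lower_bound_local (eta : R) m n (I J : set nat) : (m <= n)%N ->
  (forall i, (i < m)%N -> J i -> I i) -> lower_bound eta n I -> lower_bound eta m J.
Proof.
move=> mn JI lb v v0; rewrite -(psum_trunc v mn) -(synth_trunc phi v mn); apply: lb => i Ii.
by rewrite /trunc; case: ltnP => // im; apply: v0 => /(JI i im).
Qed.

(** The number of colours and [eta] are fixed before [n]; the compactness argument rests on this
    uniformity. *)
Lemma finite_coloring : 1 <= B -> (forall i, sqnorm (phi i) = 1) ->
  exists (r : nat) (eta : R), 0 < eta /\ forall n, exists c : nat -> 'I_r,
    forall j, lower_bound eta n [set i | c i = j].
Proof.
move=> B1 phi1; pose alpha : R[i] := (1 - B^-1)%:C.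
have Bi : 0 < B^-1 <= 1 by rewrite invr_gt0 B0 /= invf_le1.
(* [(1 - 1 / r) ^+ 2 > 1 - 2 / r > 1 - 1 / B] *)
have [r0 r0P] : exists r0 : nat, 2 * B < r0%:R.
  by exists (Num.bound (2 * B)); apply: le_lt_trans (archi_boundP _); rewrite ?ler_norm // mulr_ge0 // ltW.
pose r := r0.+1.
have alr : alpha < (r.-1%:R / r%:R) ^+ 2.
  have -> : (r.-1%:R / r%:R : R[i]) = ((r.-1%:R / r%:R : R))%:C.
    by rewrite rmorphM fmorphV !rmorph_nat.
  rewrite -rmorphXn ltcR /r /= -[r0.+1]addn1 natrD.
  have q0 : 0 < r0%:R :> R by apply: lt_trans r0P; rewrite mulr_gt0.
  have h : B^-1 > 2 / (r0%:R + 1).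
    rewrite -[X in X < _]invrK ltf_pV2 ?posrE ?invr_gt0 ?divr_gt0 ?addr_gt0 //.
    rewrite invf_div ltr_pdivlMr //; move: r0P; lra.
  have -> : (r0%:R / (r0%:R + 1)) ^+ 2 = 1 - 2 / (r0%:R + 1) + ((r0%:R + 1)^-1) ^+ 2 :> R.
    field; rewrite gt_eqF // addr_gt0 //.
  apply: ltr_wpDr; first exact: sqr_ge0.
  by rewrite ltrD2l ltrN2.
have al0 : 0 <= alpha by rewrite ler0c subr_ge0; case/andP: Bi.
have [s [sR s1 paved]] := paving al0 (ltn0Sn r0) alr.
have [sr sE] : exists sr, s = sr%:C by apply/complex_realP.
have sr1 : sr < 1 by rewrite -ltcR -sE.
(* On each class, paving bounds [1 - G / B] by [sr], that is [G >= B * (1 - sr)] for the Gram matrix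
   [G]. *)
exists r, (B * (1 - sr)); split; first by rewrite mulr_gt0 // subr_gt0.
(* Since [ell2_dot] is linear in its first argument, the Gram entry at [(i, j)] pairs [phi j] with
   [phi i]. *)
move=> n; pose H : 'M[R[i]]_n :=
  \matrix_(i, j) ((i == j)%:R - (B^-1)%:C * ell2_dot (phi j) (phi i)).
have conjE (z : R[i]) : Num.conj z = z^*%C by [].
pose toF (v : 'I_n -> R[i]) (k : nat) : R[i] := if insub k is Some i then v i else 0.
have toFE v (i : 'I_n) : toF v i = v i by rewrite /toF valK.
have dotvE v : dotv v v = (psum (toF v) n)%:C.
  rewrite /psum big_mkord rmorph_sum; apply: eq_bigr => i _.
  rewrite toFE sqr_modulus conjE; case: (v i) => p q.
  by simpc; rewrite /=; congr (_ +i* _); ring.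
have qE v : qform H v v = (psum (toF v) n - B^-1 * sqnorm (synth phi (toF v) n))%:C.
  have -> : qform H v v = dotv v v -
      (B^-1)%:C * \sum_i \sum_j Num.conj (v i) * v j * ell2_dot (phi j) (phi i).
    rewrite mulr_sumr -sumrB; apply: eq_bigr => i _.
    rewrite mulr_sumr; rewrite (eq_bigr (fun j => Num.conj (v i) * (i == j)%:R * v j
      - (B^-1)%:C * (Num.conj (v i) * v j * ell2_dot (phi j) (phi i)))).
      rewrite sumrB; congr (_ - _); rewrite (bigD1 i) //= eqxx mulr1 big1 ?addr0 // => j ji.
      by rewrite eq_sym (negbTE ji) mulr0 mul0r.
    by move=> j _; rewrite !mxE; ring.
  rewrite dotvE rmorphB rmorphM /= -dot_self; congr (_ - _ * _).
  rewrite {2}/synth dot_sumr big_mkord; apply: eq_bigr => i _.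
  rewrite /synth dot_suml big_mkord; apply: eq_bigr => j _.
  by rewrite !toFE dotZl dotZr conjE; ring.
have hc : hermitian_contraction H.
  split.
  - apply/matrixP => i j; rewrite !mxE conjE rmorphB rmorphM /= dot_conj.
    by rewrite conjc_nat oppr0 eq_sym.
  - move=> v; rewrite qE dotvE lecR gerBl mulr_ge0 ?sqnorm_ge0 //; by case/andP: Bi => /ltW.
  - move=> v; rewrite qE ler0c subr_ge0 mulrC ler_pdivrMr // mulrC.
    exact: sqnorm_synth B0 bessel _ _.
have Hd i : H i i <= alpha.
  by rewrite mxE eqxx dot_self phi1 -rmorphM /= mulr1 -[1%:R]/(1%:C) -rmorphB.
have [c cP] := paved n H hc Hd.
(* Indices from [n] on get the default colour [ord0]; the bound at stage [n] reads only the indices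
   below [n]. *)
exists (fun k => if insub k is Some i then c i else ord0) => j v v0.
have vT : psum v n = psum (toF (fun i => v i)) n /\
    synth phi v n = synth phi (toF (fun i => v i)) n.
  split; rewrite /psum /synth !big_mkord; apply: eq_bigr => i _; by rewrite toFE.
rewrite vT.1 vT.2; have := cP j (fun i => v i).
rewrite qE dotvE sE -rmorphM /= lecR => h.
set p := psum _ _ in h *; set q := sqnorm _ in h *.
have : B^-1 * q >= (1 - sr) * p.
  suff : p - B^-1 * q <= sr * p by lra.
  apply: h => i ci; apply: v0 => /=; rewrite valK => ce; by rewrite ce eqxx in ci.
by rewrite ler_pdivlMl // mulrA.
Qed.

End Riesz.

Theorem mainTheorem2 (R : realType) (phi : nat -> ell2 R)
    (phi_frame : is_frame phi)
    (phi_unit : forall n : nat, ell2_norm (phi n) = 1) :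
  exists r : nat, (1 <= r)%N /\
    exists A : 'I_r -> set nat,
      partition [set: 'I_r] A [set: nat] /\
      forall j : 'I_r, is_riesz_sequence (A j) phi.
Proof.
have [A0 [B' [_ B'0 frame]]] := phi_frame.
(* Enlarging the frame bound ensures [1 <= B], hence a nonnegative diagonal [1 - 1 / B]. *)
set B := B' + 1; have B0 : 0 < B by rewrite addr_gt0.
have B1 : 1 <= B by rewrite lerDr ltW.
have bessel x n : \sum_(0 <= i < n) modulus (ell2_dot x (phi i)) ^+ 2 <= B * sqnorm x.
  apply: (@le_trans _ _ (B' * sqnorm x)); last by rewrite ler_wpM2r ?sqnorm_ge0 // lerDl.
  rewrite -lee_fin -sqr_ell2_norm; apply: le_trans (frame x).2.
  rewrite -sumEFin; apply: nneseries_lim_ge => k _ _; by rewrite lee_fin sqr_ge0.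
have phi1 i : sqnorm (phi i) = 1 by rewrite -sqr_ell2_norm phi_unit expr1n.
have [r [eta [eta0 fin]]] := finite_coloring B0 bessel B1 phi1.
pose P n (c : nat -> 'I_r) := forall j, lower_bound phi eta n [set i | c i = j].
have [c cP] : exists c, forall n, P n c.
  apply: konig => //.
  - by move=> m n c mn Pc j; apply: lower_bound_local (Pc j).
  - move=> n c c' cc' Pc j; apply: lower_bound_local (Pc j) => // i ilt /= <-.
    exact: cc'.
(* Blocks of a partition are nonempty, so only the colours that occur are kept and renumbered. *)
pose D := [set j | `[< exists n, c n = j >]]%SET.
have cD n : c n \in D by rewrite inE; apply/asboolP; exists n.
exists #|D|; split; first by apply/card_gt0P; exists (c 0%N).
exists (fun k => [set n | c n = enum_val k]); split; last first.
  by move=> k; apply: (riesz_of_lower_bound B0 bessel eta0) => n; exact: cP.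
split.
- apply/seteqP; split=> // n _; exists (enum_rank_in (cD n) (c n)) => //=.
  by rewrite enum_rankK_in.
- apply/trivIsetP => k l _ _ kl; apply/seteqP; split=> // n /= [nk nl].
  by move/eqP: kl; apply; apply: enum_val_inj; rewrite -nk.
move=> k _; have := enum_valP k; rewrite inE => /asboolP[n cn]; by exists n.
Qed.
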